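(* The periodic Macdonald spherical functions $M_\lambda^{(c)}$, $\lambda\in P_c$, form a basis of the algebra $\mathcal{C}(\mathcal{P}_c)$ of functions $f:\mathcal{P}_c\to\mathbb{C}$.
   Context: Root data. $V$ is a real finite-dimensional Euclidean vector space with inner product $\langle\cdot,\cdot\rangle$, spanned by an irreducible reduced crystallographic root system $R_0$ of rank $n$, with root lattice $Q$, weight lattice $P$, Weyl group $W_0$, a fixed choice of positive roots $R_0^+$ and the corresponding cone of dominant weights $P^+$. For $x\in V\setminus\{0\}$ put $x^\vee:=2x/\langle x,x\rangle$, and $R_0^\vee=\{\alpha^\vee\mid\alpha\in R_0\}$. Let $\varphi$ and $\vartheta$ be the highest root and the highest short root of $R_0^+$ (equal if $R_0$ is simply-laced), and $u_\varphi=2/\langle\varphi,\varphi\rangle$. Fix an admissible pair $(R_0,\hat R_0)$: $\hat R_0$ is either $R_0^\vee$ or $u_\varphi R_0$. For $\alpha\in R_0$ let $\hat\alpha:=\alpha^\vee$ if $\hat R_0=R_0^\vee$, and $\hat\alpha:=u_\varphi\alpha$ if $\hat R_0=u_\varphi R_0$; $\hat R_0^+=\{\hat\alpha\mid\alpha\in R_0^+\}$; $\hat P$ is the weight lattice of $\hat R_0$. Let $t:R_0\to(-1,1)\setminus\{0\}$ satisfy $t_{w\alpha}=t_\alpha$ for all $w\in W_0$, $\alpha\in R_0$. Fix an integer $c>1$. Macdonald spherical functions. For $\lambda\in P^+$, $M_\lambda:V\to\mathbb{C}$ is the $W_0$-invariant trigonometric polynomial $M_\lambda(\xi)=\sum_{v\in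 W_0}C(v\xi)e^{i\langle v\xi,\lambda\rangle}$ with $C(\xi)=\prod_{\alpha\in R_0^+}\frac{1-t_\alpha e^{-i\langle\xi,\alpha\rangle}}{1-e^{-i\langle\xi,\alpha\rangle}}$. Alcoves and nodes. $P_c=\{\lambda\in P\mid 0\le\langle\lambda,\beta\rangle\le c\ \forall\beta\in\hat R_0^+\}$ and $\hat P_c=\{\mu\in\hat P\mid 0\le\langle\mu,\alpha\rangle\le c\ \forall\alpha\in R_0^+\}$. For $\mu\in\hat P$, $\xi_\mu=\xi_\mu(t)\in V$ is the unique global minimum of the radially unbounded strictly convex function $\mathcal{V}_\mu:V\to\mathbb{R}$, $$\mathcal{V}_\mu(\xi)=\frac c2\langle\xi,\xi\rangle-2\pi\langle\hat\rho+\mu,\xi\rangle+\sum_{\alpha\in R_0^+}\frac{2}{\langle\alpha,\hat\alpha^\vee\rangle}\int_0^{\langle\xi,\alpha\rangle}v_\alpha(x)\,dx,$$ where $\hat\rho=\frac12\sum_{\beta\in\hat R_0^+}\beta$ and $v_\alpha(x)=(1-t_\alpha^2)\int_0^x\frac{dy}{1-2t_\alpha\cos(y)+t_\alpha^2}$. Put $\mathcal{P}_c=\{\xi_\mu\mid\mu\in\hat P_c\}$. For $\lambda\in P_c$, $M_\lambda^{(c)}\in\mathcal{C}(\mathcal{P}_c)$ is the restriction of $M_\lambda$ to $\mathcal{P}_c$. *)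

(* Defs.v *)
From HB Require Import structures.
From mathcomp Require Import all_boot all_order all_algebra finmap.
From mathcomp Require Import all_classical all_reals all_analysis.
From mathcomp Require Import complex.

Set Implicit Arguments.
Unset Strict Implicit.
Unset Printing Implicit Defensive.

Import Order.TTheory GRing.Theory Num.Theory numFieldNormedType.Exports.

Local Open Scope classical_set_scope.
Local Open Scope fset_scope.
Local Open Scope ring_scope.

Section Basis.
Variables (K : fieldType) (E : lmodType K) (I : choiceType).

(* The sums are over finite sets of indices, so that no finiteness of I is
   presupposed. *)
Definition is_basis (b : I -> E) : Prop :=
  (forall (s : {fset I}) (k : I -> K),
     \sum_(i <- s) k i *: b i = 0 -> forall i, i \in s -> k i = 0) /\
  (forall f : E, exists (s : {fset I}) (k : I -> K),
     f = \sum_(i <- s) k i *: b i).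

End Basis.

Section RootSystems.
Variables (R : realType) (V : vectType R) (form : {dot V for idfun}).

Definition coroot (x : V) : V := (2 / form x x) *: x.

Definition reflection (a : V) : 'End(V) :=
  linfun (fun x : V => x - form x (coroot a) *: a).

Lemma reflectionE (a x : V) :
  reflection a x = x - form x (coroot a) *: a.
Proof.
have lin : linear (fun x : V => x - form x (coroot a) *: a).
  move=> k u v; rewrite linearPl /= scalerDl -scalerA scalerBr opprD.
  by rewrite addrACA.
pose f : {linear V -> V} := HB.pack
  (fun x : V => x - form x (coroot a) *: a) (GRing.isLinear.Build _ _ _ _ _ lin).
exact: (lfunE f x).
Qed.

Record root_system (R0 : {fset V}) : Prop := RootSystem {
  root_neq0 : forall a, a \in R0 -> a != 0;
  root_span : <<R0>>%VS = fullv;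
  root_reflection : forall a b, a \in R0 -> b \in R0 -> reflection a b \in R0;
  root_integral : forall a b, a \in R0 -> b \in R0 ->
    form b (coroot a) \is a Num.int;
  root_reduced : forall a (k : R), a \in R0 -> k *: a \in R0 ->
    k = 1 \/ k = -1 }.

Definition irreducible_roots (R0 : {fset V}) : Prop :=
  R0 != fset0 /\
  forall A : {fset V}, A `<=` R0 -> A != fset0 -> A != R0 ->
    exists a b, [/\ a \in A, b \in R0 `\` A & form a b != 0].

Definition positive_roots (R0 Rp : {fset V}) : Prop :=
  exists2 u : V, (forall a, a \in R0 -> form a u != 0) &
    Rp = [fset a in R0 | 0 < form a u].

Definition highest_root (Rp : {fset V}) (phi : V) : Prop :=
  phi \in Rp /\ forall a, a \in Rp ->
    exists k : V -> nat, phi - a = \sum_(b <- Rp) b *+ k b.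

Inductive weyl_group (R0 : {fset V}) : 'End(V) -> Prop :=
| weyl_id : weyl_group R0 \1%VF
| weyl_reflection a w : a \in R0 -> weyl_group R0 w ->
    weyl_group R0 (reflection a \o w)%VF.

Definition weight_lattice (S : {fset V}) : set V :=
  [set x | forall b, b \in S -> form x (coroot b) \is a Num.int].

Definition alcove (L : set V) (S : {fset V}) (c : nat) : set V :=
  [set x | L x /\ forall b, b \in S -> 0 <= form x b <= c%:R].

(* The two choices of the root system \hat R_0 in an admissible pair:
   R_0^\vee and u_phi R_0 with u_phi = 2 / <phi, phi>. *)
Inductive admissible_pair := DualRoots | RescaledRoots.

Definition hat (p : admissible_pair) (phi a : V) : V :=
  match p with
  | DualRoots => coroot a
  | RescaledRoots => (2 / form phi phi) *: a
  end.

Definition hat_roots (p : admissible_pair) (phi : V) (S : {fset V}) : {fset V} :=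
  [fset hat p phi a | a in S].

End RootSystems.

Section SphericalFunctions.
Variables (R : realType) (V : vectType R) (form : {dot V for idfun}).
Variables (R0 Rp : {fset V}) (t : V -> R).

Definition expi (x : R) : R[i] := Complex (cos x) (sin x).

Definition macdonald_C (xi : V) : R[i] :=
  \prod_(a <- Rp) ((1 - (t a)%:C%C * expi (- form xi a)) /
                   (1 - expi (- form xi a))).

Definition macdonald_sum (lambda xi : V) : R[i]^o :=
  \sum_(v \in weyl_group form R0)
     (macdonald_C ((v : 'End(V)) xi) * expi (form (v xi) lambda)).

(* the points at which no denominator of [macdonald_sum] vanishes *)
Definition regular_point (xi : V) : Prop :=
  forall a, a \in R0 -> expi (- form xi a) != 1.

(* the filter of Euclidean neighbourhoods of xi, restricted to the (dense) set
   of regular points *)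
Definition regular_nbhs (xi : V) : set_system V :=
  filter_from [set e : R | 0 < e]
    (fun e => [set z | regular_point z /\ Num.sqrt (form (z - xi) (z - xi)) < e]).

(* The poles of the individual terms of [macdonald_sum] cancel, the sum being
   a trigonometric polynomial in xi; its values off the regular points are
   those of the continuous extension. *)
Definition macdonald_spherical (lambda xi : V) : R[i]^o :=
  lim (macdonald_sum lambda z @[z --> regular_nbhs xi]).

End SphericalFunctions.

Section BetheNodes.
Variables (R : realType) (V : vectType R) (form : {dot V for idfun}).
Variables (Rp : {fset V}) (phi : V) (p : admissible_pair) (t : V -> R) (c : nat).

(* the integral of f from a to b, with the usual sign when b < a *)
Definition oriented_integral (f : R -> R) (a b : R) : R :=
  if a <= b then \int[lebesgue_measure]_(x in `[a, b]) f x
  else - \int[lebesgue_measure]_(x in `[b, a]) f x.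

Definition bethe_v (s x : R) : R :=
  (1 - s ^+ 2) *
  oriented_integral (fun y => (1 - 2 * s * cos y + s ^+ 2)^-1) 0 x.

Definition hat_rho : V := 2^-1 *: \sum_(b <- hat_roots form p phi Rp) b.

Definition bethe_potential (mu xi : V) : R :=
  c%:R / 2 * form xi xi - 2 * pi * form (hat_rho + mu) xi +
  \sum_(a <- Rp) 2 / form a (coroot form (hat form p phi a)) *
    oriented_integral (bethe_v (t a)) 0 (form xi a).

Definition bethe_node (mu : V) : V :=
  xget 0 [set xi | forall z, z != xi ->
                     bethe_potential mu xi < bethe_potential mu z].

End BetheNodes.

(* Main.v *)
(** Let W be the Weyl group and F_l(xi) = sum_{v in W} C(v xi) e^(i <v xi, l>)
    for every weight l; F_l is M_l when l is dominant. Exponentiating the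
    equation "gradient of the potential = 0" gives the Bethe equations, which
    say that across the affine wall of the alcove the factor C behaves at a node
    as it does, identically, across a simple wall. Hence the values (F_l(xi))_l
    satisfy a straightening relation across every wall of the alcove, and a
    relation sum_mu d_mu F_l(xi_mu) = 0 that holds for l in P_c propagates
    to all weights l.

    Strong monotonicity and equivariance of the gradient put the nodes in the
    open alcove 0 < <xi, a> < 2 pi, so the points v xi_mu define pairwise distinct
    characters of the weight lattice, and C does not vanish there. By
    independence of characters all d_mu are 0. So |\hat P_c| <= |P_c|, and the
    same inequality for the dual admissible pair (with t = 0) is
    |P_c| <= |\hat P_c|. The matrix (M_l(xi_mu)) is therefore square with
    trivial kernel. *)

Require Import Defs.
From HB Require Import structures.
From mathcomp Require Import all_boot all_order all_algebra finmap.
From mathcomp Require Import all_classical all_reals all_analysis.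
From mathcomp Require Import complex.
From mathcomp Require Import ring lra zify.

Set Implicit Arguments.
Unset Strict Implicit.
Unset Printing Implicit Defensive.

Import Order.TTheory GRing.Theory Num.Theory numFieldNormedType.Exports.

Local Open Scope classical_set_scope.
Local Open Scope ring_scope.

(** Both admissible pairs are handled at once by writing hat a as [k a *: a] with a positive
    Weyl-invariant scalar [k]. The affine wall is given by a root [g] whose rescaling is at the same
    time its coroot and the highest rescaled root; the pairing of [g] with any other positive hat b
    is then 0 or 1, and with hat g it is 2. This is what lets one component of the Bethe equation
    match the change of C under the affine reflection: by the closed form of v, the phase attached
    to b is, up to sign and inversion, the quotient of the b-factors of C at opposite arguments.
    Propagation to all weights terminates because crossing a violated wall brings a weight closer to
    a fixed interior point of the alcove, by a uniform amount. The nodes are defined as minimizers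
    with a default value, and M as a limit through regular points. So minimizers have to be
    produced, here as zeros of the gradient found by iteration; and since the nodes turn out to be
    regular, the limit there is the plain value of the sum. *)

Section DotProduct.
Variables (R : realType) (V : vectType R) (form : {dot V for idfun}).
Implicit Types (x y z : V) (a : R).

(** * Euclidean linear algebra *)

Lemma dotC x y : form x y = form y x.
Proof. by rewrite hermC /= expr0 mul1r. Qed.

Lemma dot0l x : form 0 x = 0. Proof. exact: linear0l. Qed.
Lemma dot0r x : form x 0 = 0. Proof. exact: linear0r. Qed.
Lemma dotDl x y z : form (x + y) z = form x z + form y z.
Proof. exact: linearDl. Qed.
Lemma dotDr x y z : form z (x + y) = form z x + form z y.
Proof. exact: linearDr. Qed.
Lemma dotNl x z : form (- x) z = - form x z.
Proof. exact: linearNl. Qed.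
Lemma dotNr x z : form z (- x) = - form z x.
Proof. exact: linearNr. Qed.
Lemma dotBl x y z : form (x - y) z = form x z - form y z.
Proof. by rewrite dotDl dotNl. Qed.
Lemma dotBr x y z : form z (x - y) = form z x - form z y.
Proof. by rewrite dotDr dotNr. Qed.
Lemma dotZl a x z : form (a *: x) z = a * form x z.
Proof. exact: linearZl_LR. Qed.
Lemma dotZr a x z : form z (a *: x) = a * form z x.
Proof. exact: linearZr_LR. Qed.
Lemma dotMnl x z n : form (x *+ n) z = form x z *+ n.
Proof. exact: linearMnl. Qed.

Definition dotE := (dotDl, dotDr, dotNl, dotNr, dotZl, dotZr, dot0l, dot0r).

Lemma dot_suml I (r : seq I) (P : pred I) (E : I -> V) z :
  form (\sum_(i <- r | P i) E i) z = \sum_(i <- r | P i) form (E i) z.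
Proof. exact: linear_sumlz. Qed.
Lemma dot_sumr I (r : seq I) (P : pred I) (E : I -> V) z :
  form z (\sum_(i <- r | P i) E i) = \sum_(i <- r | P i) form z (E i).
Proof. exact: linear_sumr. Qed.

Lemma dot_gt0 x : x != 0 -> 0 < form x x.
Proof. exact: neq0_dnorm_gt0. Qed.
Lemma dot_ge0 x : 0 <= form x x.
Proof.
by case: (eqVneq x 0) => [->|/dot_gt0 /ltW//]; rewrite dot0l.
Qed.
Lemma dot_eq0 x : form x x = 0 -> x = 0.
Proof. by move=> h; apply/eqP/negPn/negP => /dot_gt0; rewrite h ltxx. Qed.

Lemma cauchy_schwarz x y : form x y ^+ 2 <= form x x * form y y.
Proof.
case: (eqVneq y 0) => [->|/dot_gt0 y0]; first by rewrite !dotE expr0n mulr0.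
have := dot_ge0 (form y y *: x - form x y *: y).
rewrite !dotE (dotC y x) => h.
rewrite -subr_ge0 -(pmulr_rge0 _ y0); apply: le_trans h _; lra.
Qed.

Lemma cauchy_schwarz_eq x y : y != 0 ->
  form x x * form y y <= form x y ^+ 2 -> x = (form x y / form y y) *: y.
Proof.
move=> yn0 h; have y0 := dot_gt0 yn0.
suff : form y y *: x - form x y *: y = 0.
  move/eqP; rewrite subr_eq0 => /eqP e.
  by rewrite mulrC -scalerA -e scalerA mulVf ?gt_eqF// scale1r.
apply: dot_eq0; apply/eqP; rewrite eq_le dot_ge0 andbT.
by rewrite !dotE (dotC y x); nra.
Qed.

Lemma dot_inj x y : (forall z, form x z = form y z) -> x = y.
Proof.
by move=> h; apply/eqP; rewrite -subr_eq0; apply/eqP/dot_eq0; rewrite dotBl h subrr.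
Qed.

(** The Gram matrix is invertible: a row that it kills gives a combination of the basis orthogonal
    to every basis vector, hence to itself. The columns of the inverse are the coordinates of the
    dual vectors. *)
Lemma dual_basis n (e : n.-tuple V) : basis_of fullv e ->
  exists d : 'I_n -> V, [/\ forall i j : 'I_n, form e`_i (d j) = (i == j)%:R,
    forall x, x = \sum_(i < n) form x (d i) *: e`_i &
    forall x, x = \sum_(i < n) form x e`_i *: d i].
Proof.
move=> be; have fe := basis_free be.
pose G := \matrix_(i < n, j < n) form e`_i e`_j.
have Gu : G \in unitmx.
  rewrite -row_free_unit; apply/row_freeP; apply/row_freeP.
  rewrite -kermx_eq0; apply/eqP/row_matrixP => k.
  set r := row k _; rewrite row0.
  have rG : r *m G = 0 by rewrite /r -row_mul mulmx_ker row0.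
  pose y := \sum_(i < n) r 0 i *: e`_i.
  have ye (j : 'I_n) : form y e`_j = 0.
    have := congr1 (fun M : 'rV[R]_n => M 0 j) rG; rewrite !mxE => rj.
    rewrite -[RHS]rj dot_suml.  by apply: eq_bigr => i _; rewrite dotZl [G i j]mxE.
  have y0 : y = 0.
    by apply: dot_eq0; rewrite {2}/y dot_sumr big1// => i _; rewrite dotZr ye mulr0.
  apply/rowP => i; rewrite [RHS]mxE.
  by have/freeP := fe; move=> /(_ (fun i => r 0 i) y0 i).
pose d (j : 'I_n) := \sum_(k < n) (invmx G) k j *: e`_k.
have ed (i j : 'I_n) : form e`_i (d j) = (i == j)%:R.
  have := congr1 (fun M : 'M[R]_n => M i j) (mulmxV Gu); rewrite [LHS]mxE [RHS]mxE => <-.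
  by rewrite dot_sumr; apply: eq_bigr => k _; rewrite dotZr mulrC [G i k]mxE.
have exp1 x : x = \sum_(i < n) form x (d i) *: e`_i.
  have xe : x = \sum_(i < n) coord e i x *: e`_i.
    by apply: (coord_basis be); exact: memvf.
  rewrite [LHS]xe; apply: eq_bigr => i _; congr (_ *: _).
  rewrite [in RHS]xe dot_suml (bigD1 i)//= dotZl ed eqxx mulr1 big1 ?addr0// => j ji.
  by rewrite dotZl ed (negbTE ji) mulr0.
exists d; split=> // x.
apply: dot_inj => z; rewrite [in LHS](exp1 z) dot_sumr dot_suml.
by apply: eq_bigr => i _; rewrite dotZr dotZl mulrC (dotC z).
Qed.

End DotProduct.

(** * Coroots and reflections *)

Section Reflections.
Variables (R : realType) (V : vectType R) (form : {dot V for idfun}).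
Implicit Types (a b x y : V).
Local Notation s := (reflection form).
Local Notation co := (coroot form).

Lemma dot_coroot x a : form x (co a) = 2 * form x a / form a a.
Proof. by rewrite dotZr mulrAC. Qed.

Lemma coroot0 : co 0 = 0. Proof. exact: scaler0. Qed.

Lemma coroot_scale (k : R) a : co (k *: a) = k^-1 *: co a.
Proof.
case: (eqVneq k 0) => [->|k0]; first by rewrite invr0 !scale0r coroot0.
case: (eqVneq a 0) => [->|a0]; first by rewrite !(scaler0, coroot0).
rewrite /coroot !dotE !scalerA; congr (_ *: _).
by field; rewrite k0 gt_eqF ?dot_gt0.
Qed.

Lemma corootN a : co (- a) = - co a.
Proof. by rewrite -scaleN1r coroot_scale invrN1 scaleN1r. Qed.

Lemma corootK a : co (co a) = a.
Proof.
case: (eqVneq a 0) => [->|a0]; first by rewrite !coroot0.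
rewrite {2}/coroot coroot_scale /coroot scalerA invf_div mulrA divfK ?pnatr_eq0//.
by rewrite mulfV ?gt_eqF ?dot_gt0// scale1r.
Qed.

Lemma dot_coroot_self a : a != 0 -> form a (co a) = 2.
Proof. by move=> a0; rewrite dot_coroot mulfK// gt_eqF ?dot_gt0. Qed.

Lemma dot_coroot_gt0 a x : a != 0 -> (0 < form x (co a)) = (0 < form x a).
Proof. by move=> a0; rewrite dotZr pmulr_rgt0// divr_gt0// dot_gt0. Qed.

Lemma dot_coroot_ge0 a x : a != 0 -> (0 <= form x (co a)) = (0 <= form x a).
Proof. by move=> a0; rewrite dotZr pmulr_rge0// divr_gt0// dot_gt0. Qed.

Lemma reflection_scale (k : R) a x : k != 0 -> s (k *: a) x = s a x.
Proof.
move=> k0; rewrite !reflectionE coroot_scale dotZr scalerA.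
by rewrite mulrAC mulVf// mul1r.
Qed.

Lemma reflectionN a x : s (- a) x = s a x.
Proof. by rewrite -scaleN1r reflection_scale// oppr_eq0 oner_eq0. Qed.

Lemma reflection_sym a x y : form (s a x) y = form x (s a y).
Proof.
by rewrite !reflectionE !dot_coroot dotBl dotBr dotZl dotZr (dotC form a y); ring.
Qed.

Lemma reflectionK a : involutive (s a).
Proof.
move=> x; case: (eqVneq a 0) => [->|a0].
  by rewrite !reflectionE !scaler0 !subr0.
rewrite !reflectionE dotBl dotZl dot_coroot_self//; set k := form x _.
have e : k + (k - k * 2) = 0 by ring.
by rewrite -addrA -opprD -scalerDl e scale0r subr0.
Qed.

Lemma reflection_dot a x y : form (s a x) (s a y) = form x y.
Proof. by rewrite reflection_sym reflectionK. Qed.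

Lemma reflection_self a : s a a = - a.
Proof.
case: (eqVneq a 0) => [->|a0]; first by rewrite linear0 oppr0.
by rewrite reflectionE dot_coroot_self// scaler_nat mulr2n opprD addNKr.
Qed.

Definition isometric (w : 'End(V)) := forall x y, form (w x) (w y) = form x y.

Lemma isometric_coroot w a : isometric w -> co (w a) = w (co a).
Proof. by move=> h; rewrite /coroot h linearZ. Qed.

Lemma isometric_reflection w a x : isometric w -> s (w a) (w x) = w (s a x).
Proof.
by move=> h; rewrite !reflectionE isometric_coroot// h [w (_ - _)]linearB/= [w (_ *: _)]linearZ.
Qed.

End Reflections.

(** * Root systems and their Weyl groups *)

Section RootSystem.
Variables (R : realType) (V : vectType R) (form : {dot V for idfun}).
Variables (R0 : {fset V}).
Hypothesis hR0 : root_system form R0.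
Implicit Types (a b x y : V).
Local Notation s := (reflection form).
Local Notation co := (coroot form).
Local Notation W := (weyl_group form R0).

Lemma root_refl a b : a \in R0 -> b \in R0 -> s a b \in R0.
Proof. exact: root_reflection. Qed.

Lemma root_opp a : a \in R0 -> - a \in R0.
Proof. by move=> aR; rewrite -(reflection_self form) root_refl. Qed.

Lemma root_oppE a : (- a \in R0) = (a \in R0).
Proof. by apply/idP/idP => /root_opp; rewrite ?opprK. Qed.

Lemma root_dot_gt0 a : a \in R0 -> 0 < form a a.
Proof. by move=> /(root_neq0 hR0)/dot_gt0. Qed.

(** Both Cartan integers are positive. If one of them is 1, a reflection produces the difference up
    to sign. If both are at least 2, equality holds in the Cauchy-Schwarz inequality, so the roots
    are proportional, and reducedness leaves only the excluded case a = b and the case a = -b, which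
    contradicts positivity. *)
Lemma root_sub a b : a \in R0 -> b \in R0 -> a != b -> 0 < form a b ->
  a - b \in R0.
Proof.
move=> aR bR ab ab0.
have a0 := root_dot_gt0 aR; have b0 := root_dot_gt0 bR.
have an0 := root_neq0 hR0 aR; have bn0 := root_neq0 hR0 bR.
have /intrP[m em] := root_integral hR0 aR bR.
have /intrP[n en] := root_integral hR0 bR aR.
have m0 : 0 < m%:~R :> R by rewrite -em dot_coroot_gt0// dotC.
have n0 : 0 < n%:~R :> R by rewrite -en dot_coroot_gt0.
move: m0 n0; rewrite !ltr0z => m0 n0.
have [m1|m1] := eqVneq m 1.
  have : s a b \in R0 by exact: root_refl.
  by rewrite reflectionE em m1 scale1r => /root_opp; rewrite opprB.
have [n1|n1] := eqVneq n 1.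
  have : s b a \in R0 by exact: root_refl.
  by rewrite reflectionE en n1 scale1r.
have m2 : 2 <= m%:~R :> R by rewrite (_ : 2 = 2%:~R)// ler_int; lia.
have n2 : 2 <= n%:~R :> R by rewrite (_ : 2 = 2%:~R)// ler_int; lia.
have /(cauchy_schwarz_eq bn0) e : form a a * form b b <= form a b ^+ 2.
  have e1 : m%:~R * form a a = 2 * form a b.
    by rewrite -em dot_coroot (dotC _ b) divfK// gt_eqF.
  have e2 : n%:~R * form b b = 2 * form a b by rewrite -en dot_coroot divfK// gt_eqF.
  have : 2 * form a a <= 2 * form a b by rewrite -e1 ler_pM2r.
  have : 2 * form b b <= 2 * form a b by rewrite -e2 ler_pM2r.
  by nra.
have := aR; rewrite e => /(root_reduced hR0 bR)[] k; last first.
  by have := divr_gt0 ab0 b0; rewrite k; lra.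
by move: ab; rewrite e k scale1r eqxx.
Qed.

Lemma root_add a b : a \in R0 -> b \in R0 -> a != - b -> form a b < 0 ->
  a + b \in R0.
Proof.
move=> aR bR ab h; rewrite -[b]opprK; apply: root_sub => //.
  exact: root_opp.
by rewrite dotNr oppr_gt0.
Qed.

Lemma weyl_refl a : a \in R0 -> W (s a).
Proof.
move=> aR; rewrite -[s a]comp_lfun1r; apply: weyl_reflection => //.
exact: weyl_id.
Qed.

Lemma weyl_comp v w : W v -> W w -> W (v \o w)%VF.
Proof.
elim=> [|a v' aR _ IH] hw; first by rewrite comp_lfun1l.
by rewrite -comp_lfunA; apply: weyl_reflection => //; exact: IH.
Qed.

Lemma weyl_isometric w : W w -> isometric form w.
Proof.
elim=> [|a v aR _ IH] x y; first by rewrite !id_lfunE.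
by rewrite !comp_lfunE reflection_dot IH.
Qed.

Lemma weyl_root w a : W w -> a \in R0 -> w a \in R0.
Proof.
move=> hw aR; elim: hw => [|b v bR _ IH]; first by rewrite id_lfunE.
by rewrite comp_lfunE root_refl.
Qed.

Lemma weyl_inv w : W w -> exists w', [/\ W w', cancel w w' & cancel w' w].
Proof.
elim=> [|a v aR _ [v' [hv' k1 k2]]].
  by exists \1%VF; split=> [|x|x]; rewrite ?id_lfunE//; exact: weyl_id.
exists (v' \o s a)%VF; split => [|x|x].
- by apply: weyl_comp => //; exact: weyl_refl.
- by rewrite !comp_lfunE reflectionK k1.
- by rewrite !comp_lfunE k2 reflectionK.
Qed.

Lemma weyl_inj w : W w -> injective w.
Proof. by case/weyl_inv => w' [_ k _]; exact: can_inj k. Qed.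

Lemma weyl_adjoint w w' x y : W w -> cancel w' w -> form (w x) y = form x (w' y).
Proof. by move=> hw k; rewrite -{1}[y]k weyl_isometric. Qed.

Lemma eq_on_roots (f g : 'End(V)) : {in R0, f =1 g} -> f = g.
Proof.
move=> h; apply/lfunP => x; apply/eqP; rewrite -subr_eq0 -opp_lfunE -add_lfunE.
rewrite -memv_ker; have : (fullv <= lker (f - g))%VS.
  rewrite -(root_span hR0); apply/span_subvP => b bR.
  by rewrite memv_ker add_lfunE opp_lfunE subr_eq0; apply/eqP/h.
by move=> /subvP; apply; exact: memvf.
Qed.

(** The roots span, so a Weyl group element is determined by the map it induces from the finite set
    of roots to itself. *)
Lemma weyl_finite : finite_set W.
Proof.
pose f (w : 'End(V)) := [ffun a : R0 => w (val a)].
pose B := (fun g : {ffun R0 -> R0} => [ffun a => val (g a)]) @` [set: _].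
have fB : finite_set B by apply: finite_image; exact: finite_finset.
apply: (@sub_finite_set _ _ (f @^-1` B)).
  move=> w hw; exists [ffun a => insubd a (w (val a))] => //.
  apply/ffunP => a; rewrite !ffunE insubdK//.
  exact/weyl_root/valP.
apply: finite_preimage => // w1 w2 _ _ e; apply: eq_on_roots => a aR.
by have := congr1 (fun g : {ffun R0 -> V} => g [` aR]%fset) e; rewrite !ffunE.
Qed.

End RootSystem.

(** * Positive roots, simple roots and words in simple reflections *)

Section PositiveRoots.
Variables (R : realType) (V : vectType R) (form : {dot V for idfun}).
Variables (R0 : {fset V}) (u : V).
Hypothesis hR0 : root_system form R0.
Hypothesis hu : forall a, a \in R0 -> form a u != 0.
Implicit Types (a b x y z : V) (l : seq V).
Local Notation s := (reflection form).
Local Notation co := (coroot form).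
Local Notation W := (weyl_group form R0).

Definition pos_roots : {fset V} := [fset a in R0 | 0 < form a u]%fset.
Local Notation Rp := pos_roots.

Lemma posE a : (a \in Rp) = (a \in R0) && (0 < form a u).
Proof. by rewrite !inE. Qed.

Lemma pos_root a : a \in Rp -> a \in R0.
Proof. by rewrite posE => /andP[]. Qed.

Lemma pos_gt0 a : a \in Rp -> 0 < form a u.
Proof. by rewrite posE => /andP[]. Qed.

Lemma pos_neq0 a : a \in Rp -> a != 0.
Proof. by move=> /pos_root/(root_neq0 hR0). Qed.

Lemma pos_or a : a \in R0 -> (a \in Rp) || (- a \in Rp).
Proof.
move=> aR; rewrite !posE (root_oppE hR0) aR dotNl oppr_gt0/=.
by have := hu aR; rewrite neq_lt orbC.
Qed.

Lemma pos_opp a : a \in Rp -> - a \notin Rp.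
Proof.
by rewrite !posE => /andP[_ a0]; rewrite dotNl oppr_gt0 negb_and -leNgt (ltW a0) orbT.
Qed.

Lemma npos_opp a : a \in R0 -> a \notin Rp -> - a \in Rp.
Proof. by move=> aR /negbTE h; have := pos_or aR; rewrite h. Qed.

(** The height <a, u> is a real number; the induction is well-founded because only finitely many
    positive roots lie below a given one. *)
Lemma pos_ind (P : V -> Prop) :
  (forall a, a \in Rp -> (forall b, b \in Rp -> form b u < form a u -> P b) ->
    P a) ->
  forall a, a \in Rp -> P a.
Proof.
move=> h a; pose m a := #|` [fset b in Rp | form b u < form a u]%fset|.
have [n] := ubnP (m a); elim: n a => // n IH a man aR.
apply: h => // b bR ba; apply: IH => //.
apply: (@leq_trans (m a)); last by rewrite -ltnS.
apply: fproper_ltn_card; rewrite fproperE; apply/andP; split.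
  by apply/fsubsetP => c; rewrite !inE => /andP[-> /lt_trans]; exact.
apply/fsubsetPn; exists b; rewrite !inE ?ltxx ?andbF// ba.
by move: bR; rewrite posE => ->.
Qed.

Definition simple a :=
  a \in Rp /\ forall b c, b \in Rp -> c \in Rp -> a <> b + c.

Lemma simple_pos a : simple a -> a \in Rp. Proof. by case. Qed.

Lemma simple_root a : simple a -> a \in R0. Proof. by case=> /pos_root. Qed.

Lemma simple_ind (P : V -> Prop) : (forall a, simple a -> P a) ->
  (forall a b, a \in Rp -> b \in Rp -> P a -> P b -> P (a + b)) ->
  forall a, a \in Rp -> P a.
Proof.
move=> hs hD; apply: pos_ind => a aR IH.
have [/hs//|ns] := pselect (simple a).
have [[b [c [bR cR e]]]|nbc] :=
  pselect (exists b c, [/\ b \in Rp, c \in Rp & a = b + c]).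
  have b0 := pos_gt0 bR; have c0 := pos_gt0 cR.
  rewrite e; apply: hD => //; apply: IH => //; rewrite e dotDl; lra.
by case: ns; split=> // b c bR cR e; apply: nbc; exists b, c.
Qed.

Definition dominant x := forall a, a \in Rp -> 0 <= form x a.

Lemma simple_dominant x : (forall a, simple a -> 0 <= form x a) -> dominant x.
Proof.
by move=> h; apply: simple_ind => // a b _ _ ha hb; rewrite dotDr addr_ge0.
Qed.

Lemma root_sub_simple a b : simple a -> b \in Rp -> b - a \in R0 -> b - a \in Rp.
Proof.
move=> [aR sa] bR bar; apply: contraT => /(npos_opp bar); rewrite opprB => abR.
by case: (sa _ _ bR abR); rewrite addrC subrK.
Qed.

(** Induction on height. If <b, a^v> <= 0, the reflection does not lower the height. Otherwise b - a
    is a positive root with positive image, and a negative s_a b would split the simple root a as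
    s_a (b - a) + (- s_a b). *)
Lemma simple_refl_pos a b : simple a -> b \in Rp -> b != a -> s a b \in Rp.
Proof.
move=> sa bR; have aR := simple_pos sa.
have aR0 := pos_root aR; have a0 := pos_gt0 aR; have aa := root_dot_gt0 hR0 aR0.
elim/pos_ind: bR => {b} b bR IH ba.
have bR0 := pos_root bR; have b0 := pos_gt0 bR.
have sbR0 : s a b \in R0 by exact: root_refl hR0 _ _ _ _.
have [n0|n0] := leP (form b (co a)) 0.
  rewrite posE sbR0 reflectionE dotBl dotZl.
  by apply: ltr_wpDr => //; rewrite -mulNr mulr_ge0 ?oppr_ge0// ltW.
have bar : b - a \in Rp.
  apply: root_sub_simple => //; apply: (root_sub hR0) => //.
  by rewrite -(@dot_coroot_gt0 _ _ form) ?(pos_neq0 aR).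
have ba2 : b - a != a.
  rewrite subr_eq -mulr2n -scaler_nat; apply/eqP => e.
  by have := bR0; rewrite e => /(root_reduced hR0 aR0)[]; lra.
have := IH _ bar _ ba2; rewrite dotBl gtrBl => /(_ a0) h.
apply: contraT => /(npos_opp sbR0) h2.
case: sa => _ /(_ _ _ h h2) []; rewrite linearB/= reflection_self.
by rewrite opprK addrAC subrr add0r.
Qed.

Lemma simple_refl_perm a : simple a ->
  perm_eq [seq s a b | b <- [seq b <- Rp | b != a]] [seq b <- Rp | b != a].
Proof.
move=> sa; set r := [seq b <- Rp | b != a]; have aR := simple_pos sa.
have mr b : (b \in r) = (b != a) && (b \in Rp) by rewrite mem_filter.
have ur : uniq r by rewrite filter_uniq ?fset_uniq.
have uni : uniq [seq s a b | b <- r].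
  by rewrite map_inj_uniq//; exact: can_inj (reflectionK form a).
have sub : {subset [seq s a b | b <- r] <= r}.
  move=> x /mapP[b]; rewrite !mr => /andP[ba bR] ->.
  rewrite simple_refl_pos// andbT; apply: contraTneq bR => e.
  by rewrite -(reflectionK form a b) e reflection_self pos_opp.
have [|_ eqi] := uniq_min_size uni sub; first by rewrite size_map.
exact: uniq_perm.
Qed.

Lemma simple_obtuse a b : simple a -> simple b -> a != b -> form a b <= 0.
Proof.
move=> sa sb ab; rewrite leNgt; apply/negP => h.
have aR := simple_pos sa; have bR := simple_pos sb.
have abR : a - b \in R0 by apply: (root_sub hR0) => //; exact: pos_root.
have /(root_sub_simple sb aR) abp := abR.
by case: sa => _ /(_ _ _ abp bR); rewrite subrK.
Qed.

Definition act l x := foldr (fun a y => s a y) x l.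

Lemma act_cat l1 l2 x : act (l1 ++ l2) x = act l1 (act l2 x).
Proof. exact: foldr_cat. Qed.

Lemma act_weyl l : (forall a, a \in l -> a \in R0) ->
  exists2 w : 'End(V), W w & forall x, w x = act l x.
Proof.
elim: l => [|a l IH] h.
  by exists \1%VF => [|x]; [exact: weyl_id|rewrite id_lfunE].
have [|w hw e] := IH; first by move=> b bl; apply: h; rewrite inE bl orbT.
exists (s a \o w)%VF => [|x]; last by rewrite comp_lfunE/= e.
by apply: weyl_reflection => //; apply: h; rewrite inE eqxx.
Qed.

Lemma act_reflection l a x : (forall b, b \in l -> b \in R0) ->
  s (act l a) (act l x) = act l (s a x).
Proof.
move=> /act_weyl[w hw e]; rewrite -!e isometric_reflection//.
exact: weyl_isometric hw.
Qed.

Definition simple_word l := forall a, a \in l -> simple a.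

Lemma simple_word_root l : simple_word l -> forall a, a \in l -> a \in R0.
Proof. by move=> h a /h/simple_root. Qed.

(** Induction on height. A non-simple positive b has <b, a> > 0 for some simple a, since otherwise
    -b would be dominant and <b, b> <= 0. Then s_a b is positive and lower, and s_b = s_a s_(s_a b)
    s_a. *)
Lemma refl_word b : b \in R0 ->
  exists2 l, simple_word l & forall x, s b x = act l x.
Proof.
suff h : forall c, c \in Rp -> exists2 l, simple_word l & forall x, s c x = act l x.
  move=> /pos_or/orP[/h//|/h[l sl e]].
  by exists l => // x; rewrite -e reflectionN.
apply: pos_ind => {}b bR IH.
have [sb|nsb] := pselect (simple b).
  by exists [:: b] => // a; rewrite inE => /eqP->.
have [[a sa ba]|na] := pselect (exists2 a, simple a & 0 < form b a); last first.
  have /(_ b bR) : dominant (- b).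
    apply: simple_dominant => a sa; rewrite dotNl oppr_ge0 leNgt; apply/negP => h.
    by apply: na; exists a.
  by rewrite dotNl oppr_ge0 leNgt dot_gt0// pos_neq0.
have aR := simple_pos sa; have aR0 := pos_root aR.
have bna : b != a by apply: contra_notN nsb => /eqP->.
have sabR := simple_refl_pos sa bR bna.
have [|l sl e] := IH _ sabR.
  rewrite reflectionE dotBl dotZl gtrBl mulr_gt0 ?pos_gt0//.
  by rewrite dot_coroot_gt0// pos_neq0.
exists (a :: rcons l a).
  by move=> c; rewrite inE mem_rcons inE => /or3P[/eqP->|/eqP->|/sl].
move=> x; rewrite -cats1 /= act_cat/= -e.
rewrite -[s a b in RHS]/(act [:: a] b) -[s a x]/(act [:: a] x) act_reflection/=.
  by rewrite reflectionK.
by move=> c; rewrite inE => /eqP->.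
Qed.

Lemma weyl_word w : W w -> exists2 l, simple_word l & forall x, w x = act l x.
Proof.
elim=> [|a v aR _ [l sl e]]; first by exists [::] => // x; rewrite id_lfunE.
have [l' sl' e'] := refl_word aR; exists (l' ++ l).
  by move=> b; rewrite mem_cat => /orP[/sl'|/sl].
by move=> x; rewrite comp_lfunE act_cat e e'.
Qed.

(** At the letter where the image of [a] changes sign, that image must be the letter itself, the
    only positive root made negative by its simple reflection. *)
Lemma word_crossing l a : simple_word l -> a \in Rp -> act l a \notin Rp ->
  exists l1 b l2, l = l1 ++ b :: l2 /\ act l2 a = b.
Proof.
elim: l => [|b l IH] sl aR /=; first by rewrite aR.
have [lR|lnR] := boolP (act l a \in Rp) => h.
  exists [::], b, l; split=> //; apply/eqP; apply: contraNT h => h.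
  by apply: simple_refl_pos => //; apply: sl; rewrite inE eqxx.
have [|l1 [c [l2 [-> e2]]]] := IH _ aR lnR.
  by move=> c cl; apply: sl; rewrite inE cl orbT.
by exists (b :: l1), c, l2.
Qed.

(* Exchange argument: if the word without its last letter [a] makes [a]
   negative, then one of its letters cancels against [a]. *)
Lemma word_pos_id l : simple_word l -> (forall a, a \in Rp -> act l a \in Rp) ->
  forall x, act l x = x.
Proof.
have [n] := ubnP (size l); elim: n l => // n IH l; case/lastP: l => [//|l a].
rewrite size_rcons ltnS => ln sl hp x.
have sa : simple a by apply: sl; rewrite mem_rcons inE eqxx.
have sl' : simple_word l by move=> b bl; apply: sl; rewrite mem_rcons inE bl orbT.
have aR := simple_pos sa; have aR0 := pos_root aR.
have lN y : act l (- y) = - act l y.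
  by have [w _ e] := act_weyl (simple_word_root sl'); rewrite -!e linearN.
have hpa := hp _ aR; rewrite -cats1 act_cat/= reflection_self lN in hpa.
move/pos_opp: hpa; rewrite opprK => /(word_crossing sl' aR) [l1 [b [l2 [el e2]]]].
have sl1 c : c \in l1 -> simple c by move=> h; apply: sl'; rewrite el mem_cat h.
have sl2 : simple_word l2.
  by move=> c h; apply: sl'; rewrite el mem_cat inE h !orbT.
have red y : act (rcons l a) y = act (l1 ++ l2) y.
  rewrite -cats1 el !act_cat/= -e2 act_reflection ?reflectionK//.
  exact: simple_word_root.
rewrite red; apply: IH.
- move: ln; rewrite el !size_cat/= addnS => h; apply: leq_trans h; lia.
- by move=> c; rewrite mem_cat => /orP[/sl1|/sl2].
- by move=> c cR; rewrite -red hp.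
Qed.

Lemma weyl_pos_id w : W w -> (forall a, a \in Rp -> w a \in Rp) ->
  forall x, w x = x.
Proof.
move=> /weyl_word[l sl e] h x; rewrite e; apply: word_pos_id => // a aR.
by rewrite -e h.
Qed.

End PositiveRoots.

(** * The root lattice and its bidual *)

Section RootLattice.
Variables (R : realType) (V : vectType R) (form : {dot V for idfun}).
Variables (R0 : {fset V}) (u : V).
Hypothesis hR0 : root_system form R0.
Hypothesis hu : forall a, a \in R0 -> form a u != 0.
Implicit Types (a b x y z q : V) (l : seq V).
Local Notation s := (reflection form).
Local Notation co := (coroot form).
Local Notation Rp := (pos_roots form R0 u).
Local Notation simple := (simple form R0 u).

(** The root lattice: negative coefficients are covered because the roots are closed under
    opposites. The same presentation by lists of roots is what the induction in
    [minuscule_coroot_sum] shortens. *)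
Definition root_sum q := exists2 l, (forall b, b \in l -> b \in R0) &
  q = \sum_(b <- l) b.

Lemma root_sumD q q' : root_sum q -> root_sum q' -> root_sum (q + q').
Proof.
move=> [l lR ->] [l' lR' ->]; exists (l ++ l'); last by rewrite big_cat.
by move=> b; rewrite mem_cat => /orP[/lR|/lR'].
Qed.

Lemma root_sumMn q n : root_sum q -> root_sum (q *+ n).
Proof.
move=> h; elim: n => [|n IH]; last by rewrite mulrS; exact: root_sumD.
by exists [::]; rewrite ?big_nil.
Qed.

Lemma root_sumZ a (k : R) : a \in R0 -> k \is a Num.int -> root_sum (k *: a).
Proof.
have h b : b \in R0 -> root_sum b.
  by move=> bR; exists [:: b]; rewrite ?big_seq1// => c; rewrite inE => /eqP->.
move=> aR /intrP[[n|n] ->]; rewrite scaler_int.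
  exact/root_sumMn/h.
by rewrite NegzE mulrNz -mulNrz; apply/root_sumMn/h; rewrite (root_oppE hR0).
Qed.

Lemma simple_free n (D : n.-tuple V) : uniq D -> (forall a, a \in D -> simple a) ->
  free D.
Proof.
move=> uD sD.
have D_pos (i : 'I_n) : 0 < form D`_i u.
  by apply: (@pos_gt0 _ _ form R0); apply/simple_pos/sD/mem_nth; rewrite size_tuple.
(* The part of a relation with positive coefficients has nonpositive norm,
   since distinct simple roots are at obtuse angles. *)
have half (k : 'I_n -> R) : \sum_(i < n) k i *: D`_i = 0 -> forall i, k i <= 0.
  move=> e.
  pose x := \sum_(i < n | 0 < k i) k i *: D`_i.
  have ex : x = \sum_(i < n | ~~ (0 < k i)) (- k i) *: D`_i.
    apply/eqP; rewrite -subr_eq0 -sumrN (eq_bigr (fun i => k i *: D`_i)).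
      by rewrite -(bigID (fun i => 0 < k i) xpredT) e.
    by move=> i _; rewrite scaleNr opprK.
  have x0 : x = 0.
    apply: (@dot_eq0 _ _ form); apply/eqP; rewrite eq_le dot_ge0 andbT.
    rewrite {1}/x dot_suml; apply: sumr_le0 => i ki; rewrite ex dot_sumr.
    apply: sumr_le0 => j kj; rewrite dotZl dotZr mulNr mulrN oppr_le0.
    have ij : D`_i != D`_j.
      by rewrite nth_uniq ?size_tuple//; apply: contraNneq kj => /val_inj <-.
    have h : form D`_i D`_j <= 0.
      by apply: (simple_obtuse hR0 hu) ij; apply/sD/mem_nth; rewrite size_tuple.
    rewrite -leNgt in kj; have := ltW ki => {}ki.
    by rewrite mulr_ge0// mulr_le0.
  move=> i; rewrite leNgt; apply/negP => ki.
  have := congr1 (form ^~ u) x0; rewrite /x dot_suml dot0l => /eqP.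
  rewrite psumr_eq0 => [/allP/(_ i (mem_index_enum i))|j kj]; last first.
    by rewrite dotZl mulr_ge0// ltW.
  by rewrite ki/= dotZl mulf_eq0 !gt_eqF.
apply/freeP => k e i; apply/eqP; rewrite eq_le half//=.
rewrite -oppr_le0; apply: (half (fun i => - k i)).
by under eq_bigr do rewrite scaleNr; rewrite sumrN e oppr0.
Qed.

(* The simple roots form a Z-basis of the root lattice; testing [q] against
   the dual basis gives its integral coordinates. *)
Lemma root_lattice_bidual q :
  (forall x, (forall b, b \in R0 -> form x b \is a Num.int) ->
    form q x \is a Num.int) -> root_sum q.
Proof.
move=> hq.
pose D := [seq a <- enum_fset R0 | `[< simple a >]].
have DP a : a \in D -> simple a by rewrite mem_filter => /andP[/asboolP].
have PD a : simple a -> a \in D.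
  by move=> sa; rewrite mem_filter (simple_root sa) andbT; apply/asboolP.
have fD : free (in_tuple D).
  by apply: simple_free => //; rewrite filter_uniq// fset_uniq.
have spD : <<in_tuple D>>%VS = fullv.
  apply/eqP; rewrite eqEsubv subvf -(root_span hR0) /=; apply/span_subvP.
  suff h a : a \in Rp -> a \in <<D>>%VS.
    by move=> a aR; have /orP[/h//|/h] := pos_or hR0 hu aR; rewrite rpredN.
  move: a; apply: simple_ind => [a sa|a b _ _]; last exact: rpredD.
  exact/memv_span/PD.
have be : basis_of fullv (in_tuple D) by rewrite /basis_of spD eqxx.
have [d [ed exp1 _]] := dual_basis form be.
have -> : q = \sum_(i < size D) form q (d i) *: D`_i by exact: exp1.
suff h i : form q (d i) \is a Num.int.
  elim/big_ind : _ => [|x y|i _]; [by exists [::]; rewrite ?big_nil|exact: root_sumD|].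
  by apply: root_sumZ => //; apply/simple_root/DP/mem_nth.
apply: hq => b bR; rewrite dotC.
suff {b bR} hp b : b \in Rp -> form b (d i) \is a Num.int.
  have /orP[/hp//|/hp] := pos_or hR0 hu bR.
  by rewrite dotNl rpredN.
move: b; apply: simple_ind => [b sb|b c _ _ hb hc]; last by rewrite dotDl rpredD.
have bD := PD _ sb; have lt : (index b D < size D)%N by rewrite index_mem.
have := ed (Ordinal lt) i; rewrite /= nth_index// => ->.
by rewrite natr_int.
Qed.

(* If [<q, b>] > 0 for a summand [b^v] of a shortest expression of [q], then
   [s_b q = q - b^v] is shorter. *)
Lemma minuscule_coroot_sum l : (forall b, b \in l -> b \in R0) ->
  (forall a, a \in R0 -> form (\sum_(b <- l) co b) a \in [:: -1; 0; 1]) ->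
  \sum_(b <- l) co b = 0.
Proof.
have [n] := ubnP (size l); elim: n l => // n IH l ln lR hq.
set q := \sum_(b <- l) co b in hq *.
have [[b bl qb]|nb] := pselect (exists2 b, b \in l & 0 < form q b); last first.
  apply: (@dot_eq0 _ _ form); apply/eqP; rewrite eq_le dot_ge0 andbT.
  rewrite {2}/q dot_sumr big_seq; apply: sumr_le0 => b bl.
  rewrite leNgt; apply/negP; rewrite dot_coroot_gt0 ?(root_neq0 hR0) ?lR// => h.
  by apply: nb; exists b.
have bR := lR _ bl.
have qb1 : form q b = 1.
  have := hq _ bR; rewrite !inE => /or3P[]/eqP h //.
    by move: qb; rewrite h; lra.
  by move: qb; rewrite h ltxx.
have e : s b q = \sum_(c <- rem b l) co c.
  rewrite reflectionE dot_coroot qb1 mulr1 -/(co b).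
  by rewrite {1}/q (perm_big _ (perm_to_rem bl)) big_cons addrAC subrr add0r.
have : s b q = 0.
  rewrite e; apply: IH.
  - by rewrite size_rem//; case: (l) bl ln.
  - by move=> c /mem_rem/lR.
  - move=> a aR; rewrite -e reflection_sym; apply: hq.
    exact: root_refl hR0 _ _ _ _.
by move/(congr1 (s b)); rewrite reflectionK linear0.
Qed.

End RootLattice.

(** * The dominance order and the highest root *)

Section DominanceOrder.
Variables (R : realType) (V : vectType R) (form : {dot V for idfun}).
Variables (R0 : {fset V}) (u : V).
Hypothesis hR0 : root_system form R0.
Hypothesis hu : forall a, a \in R0 -> form a u != 0.
Implicit Types (a b x y z q : V) (l : seq V).
Local Notation s := (reflection form).
Local Notation co := (coroot form).
Local Notation Rp := (pos_roots form R0 u).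
Local Notation dominant := (dominant form R0 u).

(* By duality, the closed cone spanned by the positive roots. *)
Definition in_cone x := forall z, dominant z -> 0 <= form x z.

Lemma in_coneD x y : in_cone x -> in_cone y -> in_cone (x + y).
Proof. by move=> hx hy z dz; rewrite dotDl addr_ge0 ?hx ?hy. Qed.

Lemma in_coneZ (k : R) x : 0 <= k -> in_cone x -> in_cone (k *: x).
Proof. by move=> k0 hx z dz; rewrite dotZl mulr_ge0 ?hx. Qed.

Lemma pos_in_cone a : a \in Rp -> in_cone a.
Proof. by move=> aR z dz; rewrite dotC dz. Qed.

Lemma in_cone0 : in_cone 0.
Proof. by move=> z _; rewrite dot0l. Qed.

Lemma dominant_u : dominant u.
Proof. by move=> a /pos_gt0/ltW; rewrite dotC. Qed.

Lemma in_cone_ge0 x : in_cone x -> 0 <= form x u.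
Proof. by apply; exact: dominant_u. Qed.

(** Since u lies in the interior of the dominant cone, u - e x is still dominant for small e > 0.
    Pairing it with x gives - e <x, x> >= 0. The chosen e satisfies e |<x, a>| <= <a, u> for all
    positive a, as the sum dominates each single ratio. *)
Lemma in_cone_eq0 x : in_cone x -> form x u = 0 -> x = 0.
Proof.
move=> hx xu0.
pose e := (1 + \sum_(a <- Rp) `|form x a| / form a u)^-1.
have pos_ge0 a : a \in Rp -> 0 <= `|form x a| / form a u.
  by move=> aR; rewrite divr_ge0// ltW// (pos_gt0 aR).
have e0 : 0 < 1 + \sum_(a <- Rp) `|form x a| / form a u.
  by rewrite ltr_pwDl// big_seq sumr_ge0.
have /hx : dominant (u - e *: x).
  move=> a aR; have au := pos_gt0 aR.
  rewrite dotBl dotZl subr_ge0 (dotC _ u) mulrC ler_pdivrMr//.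
  apply: le_trans (ler_norm _) _; rewrite mulrC -ler_pdivrMr//.
  apply: ler_wpDl => //; rewrite (big_rem a)//= lerDl big_seq sumr_ge0// => b.
  by move=> /mem_rem/pos_ge0.
rewrite dotBr dotZr xu0 sub0r oppr_ge0 pmulr_rle0 ?invr_gt0// => h.
by apply: (@dot_eq0 _ _ form); apply/eqP; rewrite eq_le h dot_ge0.
Qed.

Hypothesis hirr : irreducible_roots form R0.

(* Take [theta] of maximal height: every root at distance at most two from
   [theta] in the non-orthogonality graph is below [theta], and no root is at
   distance three. *)
Lemma highest_root_exists :
  exists2 theta, theta \in Rp & forall a, a \in Rp -> in_cone (theta - a).
Proof.
have [a0 a0R] : exists a, a \in Rp.
  have [/fset0Pn[a aR] _] := hirr.
  by have /orP[h|h] := pos_or hR0 hu aR; eexists; exact: h.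
have [th thR thmax] : exists2 th, th \in Rp & forall a, a \in Rp -> form a u <= form th u.
  pose A := [arg max_(a > [` a0R]%fset) form (val a) u]%O.
  exists (val A) => [|a aR]; first exact: valP.
  by rewrite /A; case: arg_maxP => // i _ /(_ [` aR]%fset isT).
have thR0 := pos_root thR.
have le1 b : b \in R0 -> 0 < form th b -> in_cone (th - b).
  move=> bR h; have [->|thb] := eqVneq th b; first by rewrite subrr; exact: in_cone0.
  have dR := root_sub hR0 thR0 bR thb h.
  have /orP[|] := pos_or hR0 hu dR; first exact: pos_in_cone.
  rewrite opprB => bthR.
  have : b \in Rp.
    by rewrite posE bR; have := pos_gt0 bthR; have := pos_gt0 thR; rewrite dotBl; lra.
  by move/thmax; have := pos_gt0 bthR; rewrite dotBl; lra.
have thdom b : b \in Rp -> 0 <= form th b.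
  move=> bRp; have bR := pos_root bRp; rewrite leNgt; apply/negP => h.
  have sR : th + b \in R0.
    apply: (root_add hR0) => //; apply: contraTneq thR => ->.
    exact: pos_opp bRp.
  have b0 := pos_gt0 bRp; have th0 := pos_gt0 thR.
  have /thmax : th + b \in Rp by rewrite posE sR dotDl addr_gt0.
  by rewrite dotDl; lra.
have gt0_pos a : a \in R0 -> 0 < form th a -> a \in Rp.
  move=> aR h; apply: contraT => /(npos_opp hR0 hu aR)/thdom.
  by rewrite dotNr oppr_ge0 leNgt h.
pose near b := form th b != 0 \/
  exists a, [/\ a \in R0, form th a != 0 & form a b != 0].
have near_le b : b \in Rp -> near b -> in_cone (th - b).
  move=> bRp; have bR := pos_root bRp.
  have [thb0 [|]|thb0 _] := eqVneq (form th b) 0; first by rewrite thb0 eqxx.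
    move=> [a0' [a0'R tha0 a0'b]].
    have [a [aR tha ab]] : exists a, [/\ a \in R0, 0 < form th a & form a b != 0].
      have := tha0; rewrite neq_lt => /orP[h|h]; [exists (- a0')|exists a0'] => //.
      by rewrite (root_oppE hR0) dotNr dotNl oppr_gt0 oppr_eq0.
    have := ab; rewrite neq_lt => /orP[h|h].
      have abR : a + b \in R0.
        apply: (root_add hR0) => //; apply: contraTneq tha => ->.
        by rewrite dotNr thb0 oppr0 ltxx.
      rewrite (_ : th - b = th - (a + b) + a); last first.
        by rewrite opprD addrA addrAC subrK.
      apply: in_coneD; last exact/pos_in_cone/gt0_pos.
      by apply: le1 => //; rewrite dotDr thb0 addr0.
    have abR : a - b \in R0.
      apply: (root_sub hR0) => //; apply: contraTneq tha => ->.
      by rewrite thb0 ltxx.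
    rewrite (_ : th - b = th - a + (a - b)); last by rewrite addrA subrK.
    apply: in_coneD; first exact: le1.
    by apply/pos_in_cone/gt0_pos => //; rewrite dotBr thb0 subr0.
  by apply: le1 => //; rewrite lt_neqAle eq_sym thb0 thdom.
exists th => // b bRp; apply: near_le => //; apply: contrapT => nb.
have [_ /(_ [fset c in R0 | `[< near c >]]%fset) []] := hirr.
- by apply/fsubsetP => c; rewrite !inE => /andP[].
- apply/fset0Pn; exists th; rewrite !inE thR0; apply/asboolP; left.
  by rewrite gt_eqF// (root_dot_gt0 hR0).
- apply/eqP => /fsetP/(_ b); rewrite !inE (pos_root bRp)/= => /asboolP.
  by move/nb.
move=> c [d [cA dA cd]].
move: cA; rewrite !inE => /andP[cR /asboolP cnear].
move: dA; rewrite !inE => /andP[dnear dR]; move: dnear; rewrite dR/=.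
move=> /asboolP dnear; apply: dnear.
have [thc|thc] := eqVneq (form th c) 0; last by right; exists c.
case: cnear => [|[a [aR tha ac]]]; first by rewrite thc eqxx.
have [ad|ad] := eqVneq (form a d) 0; last by right; exists a.
(* On the path theta, a, c, d without shortcuts, the root s_c a is non-orthogonal both to theta and
   to d, so [d] is at distance at most two after all. *)
right; exists (s c a); rewrite (root_refl hR0)// reflectionE; split=> //.
  by rewrite dotBr dotZr thc mulr0 subr0.
rewrite dotBl ad sub0r dotZl oppr_eq0 dot_coroot !mulf_eq0 invr_eq0 !negb_or.
by rewrite pnatr_eq0 ac cd (gt_eqF (root_dot_gt0 hR0 cR)).
Qed.

End DominanceOrder.

(** * Oriented integrals, primitives and convexity *)

Section Calculus.
Variable R : realType.
Implicit Types (f F : R -> R) (a b x y z : R).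

Lemma is_derive1_cvg f (d : R) x : is_derive x 1 f d -> {for x, continuous f}.
Proof.
by move=> [h _]; apply/differentiable_continuous/derivable1_diffP.
Qed.

Lemma oriented_integral_primitive f F lo hi a b :
  (forall x, lo < x < hi -> is_derive x 1 F (f x)) -> continuous f ->
  lo < a < hi -> lo < b < hi -> oriented_integral f a b = F b - F a.
Proof.
move=> dF cf.
have main c d : lo < c < hi -> lo < d < hi -> c < d ->
    \int[lebesgue_measure]_(x in `[c, d]) f x = F d - F c.
  move=> /andP[lc ch] /andP[ld dh] cd.
  rewrite /Rintegral (continuous_FTC2 (F := F))//.
  - by apply: continuous_subspaceT.
  - split=> [x|//|//].
    + rewrite in_itv/= => /andP[cx xd]; have [|] := dF x => //.
      by rewrite (lt_trans lc)// (lt_trans xd).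
    + apply: cvg_at_right_filter; apply: (is_derive1_cvg (d := f c)).
      by apply: dF; rewrite lc ch.
    + apply: cvg_at_left_filter; apply: (is_derive1_cvg (d := f d)).
      by apply: dF; rewrite ld dh.
  - move=> x; rewrite in_itv/= => /andP[cx xd]; rewrite derive1E.
    by have [] := dF x => //; rewrite (lt_trans lc)// (lt_trans xd).
move=> ha hb; rewrite /oriented_integral.
have [ab|ab|<-] := ltgtP a b.
- by rewrite main.
- by rewrite main// opprB.
- by rewrite set_itv1 Rintegral_set1 subrr.
Qed.

(** The subgradient inequality for a primitive of a nondecreasing function: the mean value theorem
    gives the slope f y at some y between x and z, and f y is compared with f x. *)
Lemma oriented_integral_convex f x z : continuous f ->
  {homo f : a b / a <= b} ->
  f x * (z - x) <= oriented_integral f 0 z - oriented_integral f 0 x.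
Proof.
move=> cf mf.
(* The margin of 1 puts 0, x and z strictly inside the interval, where the primitive based at [lo]
   has a two-sided derivative. *)
pose lo := Num.min 0 (Num.min x z) - 1; pose hi := Num.max 0 (Num.max x z) + 1.
have [lx [lz l0]] : lo < x /\ lo < z /\ lo < 0.
  by split; last split; rewrite ltrBlDr !gt_min; lra.
have [hx [hz h0]] : x < hi /\ z < hi /\ 0 < hi.
  by split; last split; rewrite -ltrBlDr !lt_max; lra.
pose F y := \int[lebesgue_measure]_(t in `[lo, y]) f t.
have dF y : lo < y < hi -> is_derive y 1 F (f y).
  move=> /andP[ly yh].
  have intf : lebesgue_measure.-integrable `[lo, hi] (EFin \o f).
    apply: continuous_compact_integrable; first exact: segment_compact.
    exact: continuous_subspaceT.
  have [d e] := continuous_FTC1_closed yh intf ly (cf y).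
  by split; [exact: d|rewrite -derive1E].
rewrite !(oriented_integral_primitive (F := F) (lo := lo) (hi := hi))//
  ?lx ?lz ?l0 ?hx ?hz ?h0//.
rewrite opprB addrA subrK.
have cF c d : lo < c -> d < hi -> {within `[c, d], continuous F}.
  move=> lc dh; apply: continuous_in_subspaceT => y.
  rewrite inE/= in_itv/= => /andP[cy yd]; apply: is_derive1_cvg; apply: dF.
  by rewrite (lt_le_trans lc)// (le_lt_trans yd).
have dFi c d : lo < c -> d < hi -> forall y, y \in `]c, d[ -> is_derive y 1 F (f y).
  move=> lc dh y; rewrite in_itv/= => /andP[cy yd]; apply: dF.
  by rewrite (lt_trans lc)// (lt_trans yd).
have [xz|zx] := leP x z.
  have [y yI ->] := MVT_segment xz (dFi _ _ lx hz) (cF _ _ lx hz).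
  by move: yI; rewrite in_itv/= => /andP[xy _]; rewrite ler_wpM2r ?subr_ge0// mf.
have [y yI] := MVT_segment (ltW zx) (dFi _ _ lz hx) (cF _ _ lz hx).
move: yI; rewrite in_itv/= => /andP[_ yx] e.
rewrite -[F z - F x]opprB e -mulrN opprB ler_wnM2r ?mf// subr_le0; exact: ltW.
Qed.

End Calculus.

(** * The function v in closed form *)

Section BetheFunction.
Variables (R : realType) (s : R).
Hypothesis hs : -1 < s < 1.
Implicit Types (x y : R).

(** The expression is the squared modulus of 1 - s e^(ix); the one in [atan_den_gt0] is the real
    part of the same number. *)
Lemma poisson_den_gt0 x : 0 < 1 - 2 * s * cos x + s ^+ 2.
Proof.
have /andP[s1 s2] := hs; have c1 := cos_geN1 x; have c2 := cos_le1 x.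
have [s0|s0] := leP 0 s; first by nra.
have : 0 <= - s * (1 + cos x) by apply: mulr_ge0; lra.
by nra.
Qed.

Lemma atan_den_gt0 x : 0 < 1 - s * cos x.
Proof.
have /andP[s1 s2] := hs; have c1 := cos_geN1 x; have c2 := cos_le1 x.
have [s0|s0] := leP 0 s.
  have : 0 <= s * (1 - cos x) by apply: mulr_ge0; lra.
  by nra.
have : 0 <= - s * (1 + cos x) by apply: mulr_ge0; lra.
by nra.
Qed.

(* Closed form of [bethe_v]. *)
Definition bethe_fun x : R := x + 2 * atan (s * sin x / (1 - s * cos x)).

(** The Poisson kernel, that is 1 + 2 s cos x + 2 s^2 cos 2x + ... *)
Definition bethe_density x : R := (1 - s ^+ 2) * (1 - 2 * s * cos x + s ^+ 2)^-1.

Lemma bethe_fun_derive x : is_derive x 1 bethe_fun (bethe_density x).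
Proof.
pose N : R -> R := s *: (sin : R -> R).
pose D : R -> R := cst 1 - s *: (cos : R -> R).
have dN : is_derive x 1 N (s * cos x) by exact: is_derive_eq.
have dD : is_derive x 1 D (s * sin x).
  by apply: is_derive_eq; rewrite sub0r scalerN opprK.
have D0 := atan_den_gt0 x.
have dV := is_deriveV (_ : D x != 0) dD; have {}dV := dV (lt0r_neq0 D0).
have dq := is_deriveM dN dV.
have dc := is_derive1_comp (is_derive1_atan _) dq.
have dB := is_deriveD (is_derive_id x 1) (is_deriveZ 2 dc).
apply: (@is_derive_eq _ _ _ _ _ _ _ _ dB).
rewrite /bethe_density /D /N !fctE /=.
have dp := poisson_den_gt0 x; have cs := cos2Dsin2 x.
set c := cos x in D0 dp cs *; set n := sin x in cs *.
have n2 : n ^+ 2 = 1 - c ^+ 2 by rewrite -cs; ring.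
have Dn0 := lt0r_neq0 D0.
have -> : 1 + (s *: n * (1 - s *: c)^-1) ^+ 2 =
    (1 - 2 * s * c + s ^+ 2) / (1 - s * c) ^+ 2.
  by rewrite /GRing.scale/= expr_div_n exprMn n2; field.
have -> : s *: n *: (- (1 - s *: c) ^- 2 *: (s * n)) + (1 - s *: c)^-1 *: (s * c) =
    (s * c - s ^+ 2) / (1 - s * c) ^+ 2.
  rewrite /GRing.scale/=.
  transitivity (- s ^+ 2 * n ^+ 2 / (1 - s * c) ^+ 2 + s * c / (1 - s * c)).
    by field.
  by rewrite n2; field.
rewrite /GRing.scale/=; field.
by rewrite Dn0 lt0r_neq0.
Qed.

Lemma bethe_vE : bethe_v s = bethe_fun.
Proof.
apply/funext => x; rewrite /bethe_v.
have bd : continuous bethe_density.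
  move=> y; apply: cvgM; first exact: cvg_cst.
  apply: cvgV; first by rewrite lt0r_neq0// poisson_den_gt0.
  apply: cvgD; last exact: cvg_cst.
  apply: cvgB; first exact: cvg_cst.
  by apply: cvgM; [exact: cvg_cst|exact: continuous_cos].
have s2 : 1 - s ^+ 2 != 0 by rewrite lt0r_neq0//; case/andP: hs; nra.
pose P y := (1 - s ^+ 2)^-1 * bethe_fun y.
have dP y : Num.min 0 x - 1 < y < Num.max 0 x + 1 ->
    is_derive y 1 P ((1 - 2 * s * cos y + s ^+ 2)^-1).
  move=> _; have dB := is_deriveZ (1 - s ^+ 2)^-1 (bethe_fun_derive y).
  apply: (@is_derive_eq _ _ _ _ _ _ _ _ dB).
  by rewrite /bethe_density /GRing.scale/= mulKf.
have cP : continuous (fun y => (1 - 2 * s * cos y + s ^+ 2)^-1).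
  rewrite (_ : (fun _ => _) = fun y => (1 - s ^+ 2)^-1 * bethe_density y).
    by move=> y; apply: cvgM; [exact: cvg_cst|exact: bd].
  by apply/funext => z; rewrite /bethe_density mulKf.
have h0 : Num.min 0 x - 1 < 0 < Num.max 0 x + 1.
  by apply/andP; split; [rewrite ltrBlDr gt_min|rewrite -ltrBlDr lt_max]; lra.
have hx : Num.min 0 x - 1 < x < Num.max 0 x + 1.
  by apply/andP; split; [rewrite ltrBlDr gt_min|rewrite -ltrBlDr lt_max]; lra.
rewrite (oriented_integral_primitive dP cP h0 hx) /P -mulrBr mulVKf//.
by rewrite /bethe_fun sin0 mulr0 mul0r atan0 mulr0 addr0 subr0.
Qed.

Lemma bethe_fun_continuous : continuous bethe_fun.
Proof. by move=> x; exact: is_derive1_cvg (bethe_fun_derive x). Qed.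

(** By the mean value theorem slopes are values of the Poisson kernel, whose denominator is at least
    (1 - |s|)^2. The lower bound 0 gives the strong monotonicity of the gradient, the upper bound
    its Lipschitz property. *)
Lemma bethe_fun_slope : exists2 L : R, 0 <= L & forall x y,
  exists2 m, 0 <= m <= L & bethe_fun x - bethe_fun y = m * (x - y).
Proof.
have /andP[s1 s2] := hs.
pose L := (1 - s ^+ 2) / (1 - `|s|) ^+ 2.
have ns : 0 < 1 - `|s| by rewrite subr_gt0 ltr_norml hs.
have t2 : 0 < 1 - s ^+ 2 by nra.
have dL x : 0 <= bethe_density x <= L.
  have dp := poisson_den_gt0 x.
  apply/andP; split; first by apply: divr_ge0; exact: ltW.
  rewrite /bethe_density /L ler_pM2l// lef_pV2 ?posrE ?exprn_gt0//.
  have := cos_le1 x; have := cos_geN1 x => c1 c2.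
  have [s0|s0] := leP 0 s.
    have : 0 <= s * (1 - cos x) by apply: mulr_ge0; lra.
    by rewrite ger0_norm//; nra.
  have : 0 <= - s * (1 + cos x) by apply: mulr_ge0; lra.
  by rewrite ltr0_norm//; nra.
exists L; first by have /andP[/le_trans] := dL 0; exact.
have main x y : y <= x ->
    exists2 m, 0 <= m <= L & bethe_fun x - bethe_fun y = m * (x - y).
  move=> yx; have [|c _ e] := MVT_segment yx (fun z _ => bethe_fun_derive z).
    by apply: continuous_subspaceT => z; exact: bethe_fun_continuous.
  by exists (bethe_density c).
move=> x y; have [/main//|/ltW/main[m hm e]] := leP y x.
by exists m => //; rewrite -[LHS]opprB e -mulrN opprB.
Qed.

Lemma bethe_fun_mono : {homo bethe_fun : x y / x <= y}.
Proof.
have [L _ h] := bethe_fun_slope => x y xy.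
by have [m /andP[m0 _] e] := h y x; rewrite -subr_ge0 e mulr_ge0 ?subr_ge0.
Qed.

Lemma bethe_funN x : bethe_fun (- x) = - bethe_fun x.
Proof. by rewrite /bethe_fun sinN cosN mulrN mulNr atanN mulrN opprD. Qed.

Lemma bethe_fun_periodic x (k : int) :
  bethe_fun (x + 2 * pi * k%:~R) = bethe_fun x + 2 * pi * k%:~R.
Proof.
have h y n : bethe_fun (y + pi *+ 2 *+ n) = bethe_fun y + pi *+ 2 *+ n.
  by rewrite /bethe_fun (periodicn (@sinD2pi R)) (periodicn (@cosD2pi R)) addrAC.
have e : 2 * pi = pi *+ 2 :> R by rewrite mulr_natl.
case: k => n; first by rewrite -pmulrn mulr_natr e h.
rewrite NegzE mulrNz mulrN -pmulrn mulr_natr e.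
by apply/eqP; rewrite -subr_eq opprK -h subrK.
Qed.

(** The right-hand sides are the real and imaginary parts of (e^(ix) - s) / (1 - s e^(ix)). The
    left-hand sides follow from the double-angle formulas for twice the arctangent of [q]. *)
Lemma bethe_sin_cos x : let D := 1 - 2 * s * cos x + s ^+ 2 in
  cos (bethe_fun x) = ((1 + s ^+ 2) * cos x - 2 * s) / D /\
  sin (bethe_fun x) = (1 - s ^+ 2) * sin x / D.
Proof.
move=> D; have D0 := poisson_den_gt0 x; have A0 := atan_den_gt0 x.
rewrite /bethe_fun; set q := s * sin x / (1 - s * cos x).
have cs := cos2Dsin2 x.
have n2 : sin x ^+ 2 = 1 - cos x ^+ 2 by rewrite -cs; ring.
have q2 : 1 + q ^+ 2 = D / (1 - s * cos x) ^+ 2.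
  by rewrite /q expr_div_n exprMn n2 /D; field; rewrite lt0r_neq0.
have c0 : 0 < cos (atan q).
  by rewrite cos_gt0_pihalf// atan_gtNpi2 atan_ltpi2.
have tq : sin (atan q) = q * cos (atan q).
  by rewrite -{2}(atanK q) /tan divfK// lt0r_neq0.
have c2 : cos (atan q) ^+ 2 = (1 - s * cos x) ^+ 2 / D.
  have := cos2Dsin2 (atan q); rewrite tq exprMn -[X in X + _]mul1r -mulrDl q2.
  move=> h; rewrite -[LHS](mulKf (lt0r_neq0 (_ : 0 < D / (1 - s * cos x) ^+ 2))).
    by rewrite h mulr1 invf_div.
  by rewrite divr_gt0// exprn_gt0.
have e1 : cos (2 * atan q) = 2 * ((1 - s * cos x) ^+ 2 / D) - 1.
  by rewrite mulr_natl cos_mulr2n c2 -mulr_natl.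
have e2 : sin (2 * atan q) = 2 * (s * sin x * (1 - s * cos x) / D).
  rewrite mulr_natl sin_mulr2n tq mulrCA -expr2 c2 -mulr_natl /q.
  by field; rewrite !lt0r_neq0.
rewrite cosD sinD e1 e2; split.
  transitivity (cos x * (2 * ((1 - s * cos x) ^+ 2 / D) - 1) -
    2 * s * (1 - s * cos x) / D * sin x ^+ 2); first by field; rewrite lt0r_neq0.
  by rewrite n2 /D; field; rewrite lt0r_neq0.
by rewrite /D; field; rewrite lt0r_neq0.
Qed.

End BetheFunction.

(** * Unimodular exponentials and the factors of C *)

Section Exponentials.
Variable R : realType.
Implicit Types (s x y : R).

Lemma expi0 : expi 0 = 1 :> R[i].
Proof. by rewrite /expi cos0 sin0. Qed.

Lemma expiD x y : expi (x + y) = expi x * expi y.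
Proof.
apply/eqP; rewrite eq_complex /= cosD sinD eqxx/=; apply/eqP; ring.
Qed.

Lemma expiNK x : expi (- x) * expi x = 1.
Proof. by rewrite -expiD addNr expi0. Qed.

Lemma expi_neq0 x : expi x != 0.
Proof.
apply/eqP => e; have := expiNK x; rewrite e mulr0 => /esym/eqP.
by rewrite oner_eq0.
Qed.

Lemma expiN x : expi (- x) = (expi x)^-1.
Proof. by apply: (mulIf (expi_neq0 x)); rewrite expiNK mulVf// expi_neq0. Qed.

Lemma expi_sum (I : Type) (r : seq I) (P : pred I) (f : I -> R) :
  expi (\sum_(i <- r | P i) f i) = \prod_(i <- r | P i) expi (f i).
Proof. exact: (big_morph _ expiD expi0). Qed.

Lemma expi_lt2pi x : 0 < x < 2 * pi -> expi x != 1.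
Proof.
move=> /andP[x0 x2]; apply/eqP => /(congr1 (@complex.Re R))/= c1.
have h : 0 < sin (x / 2) by apply: sin_gt0_pi; apply/andP; split; lra.
have e : x / 2 *+ 2 = x by rewrite -mulr_natr divfK// pnatr_eq0.
have := cos_mulr2n (x / 2); rewrite e c1 cos2sin2 -mulr_natr.
by have := exprn_gt0 2 h; lra.
Qed.

Lemma expi_2pi (k : int) : expi (2 * pi * k%:~R) = 1 :> R[i].
Proof.
have h n : expi ((2 : R) * pi * n%:R) = 1.
  have -> : 2 * pi * n%:R = 0 + pi *+ 2 *+ n :> R.
    by rewrite add0r mulr_natr (mulr_natl pi 2).
  by rewrite /expi (periodicn (@sinD2pi R)) (periodicn (@cosD2pi R)) sin0 cos0.
case: k => n; first by rewrite -pmulrn h.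
by rewrite NegzE mulrNz mulrN -pmulrn expiN h invr1.
Qed.

Lemma expi_eq1 x : expi x = 1 -> exists k : int, x = 2 * pi * k%:~R.
Proof.
move=> ex; have p0 : 0 < 2 * pi :> R by rewrite mulr_gt0// pi_gt0.
pose k := Num.floor (x / (2 * pi)); exists k.
pose y := x - 2 * pi * k%:~R.
have ey : expi y = 1 by rewrite expiD expiN expi_2pi invr1 mulr1.
have y0 : 0 <= y by rewrite subr_ge0 mulrC -ler_pdivlMr// floor_le.
have y2 : y < 2 * pi.
  rewrite ltrBlDr -{1}[2 * pi]mulr1 -mulrDr mulrC -ltr_pdivrMr// addrC.
  by rewrite -intrD1 floorD1_gt.
apply/eqP; rewrite -subr_eq0 -/y; apply/negPn/negP => yn0.
have := expi_lt2pi (_ : 0 < y < 2 * pi); rewrite ey eqxx.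
by rewrite lt_neqAle eq_sym yn0 y0 y2 => /(_ isT).
Qed.

Lemma one_sub_expi_neq0 s x : -1 < s < 1 -> 1 - s%:C%C * expi x != 0.
Proof.
move=> hs; apply/eqP => /(congr1 (@complex.Re R))/=.
by rewrite mul0r subr0 => e; have := atan_den_gt0 hs x; rewrite e ltxx.
Qed.

Lemma expi_bethe_fun s x : -1 < s < 1 ->
  expi (bethe_fun s x) = (expi x - s%:C%C) / (1 - s%:C%C * expi x).
Proof.
move=> hs; have h0 := one_sub_expi_neq0 x hs.
apply: (mulIf h0); rewrite divfK//; apply/eqP; rewrite eq_complex/=.
have [-> ->] := bethe_sin_cos hs x.
set D := 1 - 2 * s * cos x + s ^+ 2.
have D0 : D != 0 by rewrite lt0r_neq0// poisson_den_gt0.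
have n2 : sin x ^+ 2 = 1 - cos x ^+ 2 by rewrite -(cos2Dsin2 x); ring.
apply/andP; split; apply/eqP.
  transitivity (((1 + s ^+ 2) * cos x - 2 * s) / D * (1 - s * cos x) +
     (1 - s ^+ 2) * s / D * sin x ^+ 2); first by field.
  by rewrite n2 /D; field.
by rewrite /D; field.
Qed.

Definition c_factor s x : R[i] := (1 - s%:C%C * expi (- x)) / (1 - expi (- x)).

Lemma one_sub_expiN_neq0 x : expi x != 1 -> 1 - expi (- x) != 0.
Proof.
by move=> h; rewrite expiN subr_eq0 eq_sym invr_eq1.
Qed.

Lemma c_factor_neq0 s x : -1 < s < 1 -> expi x != 1 -> c_factor s x != 0.
Proof.
move=> hs hx; rewrite mulf_neq0 ?invr_neq0 ?one_sub_expiN_neq0//.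
exact: one_sub_expi_neq0.
Qed.

(** The link between C and the potential: when a reflection reverses the sign of an argument, C
    acquires the exponential of a value of v, and sums of such values are what the gradient equation
    controls. *)
Lemma c_factorN s x : -1 < s < 1 -> expi x != 1 ->
  c_factor s (- x) = - expi (- bethe_fun s x) * c_factor s x.
Proof.
move=> hs hx; rewrite /c_factor opprK (expiN (bethe_fun s x)) expi_bethe_fun// expiN.
have X0 := expi_neq0 x; set X := expi x in hx X0 *.
have h1 : 1 - s%:C%C * X != 0 by exact: one_sub_expi_neq0.
have h2 : X - s%:C%C != 0.
  have := one_sub_expi_neq0 (- x) hs; rewrite expiN -/X.
  by apply: contraNneq => e; rewrite -(mulfV X0) -mulrBl e mul0r.
have h3 : 1 - X != 0 by rewrite subr_eq0 eq_sym.
have h4 : X - 1 != 0 by rewrite subr_eq0.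
by field; rewrite X0 h1 h2 h3 h4.
Qed.

End Exponentials.

(** * Independence of characters of a monoid *)

Section CharacterIndependence.
Variables (V : nmodType) (F : fieldType) (P : set V) (J : eqType).
Variable chi : J -> V -> F.

(** Dedekind's argument: translate the relation by y and subtract [chi i y] times the original. The
    first character disappears, and the coefficient of each other one is multiplied by
    [chi j y - chi i y], which is nonzero for the right choice of y. *)
Lemma character_independence (r : seq J) (c : J -> F) :
  P 0 -> (forall x y, P x -> P y -> P (x + y)) ->
  (forall j, chi j 0 = 1) -> (forall j x y, chi j (x + y) = chi j x * chi j y) ->
  uniq r ->
  {in r &, forall i j, i != j -> exists2 x, P x & chi i x != chi j x} ->
  (forall x, P x -> \sum_(j <- r) c j * chi j x = 0) ->
  {in r, forall j, c j = 0}.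
Proof.
move=> P0 PD chi0 chiD.
elim: r c => // i r IH c /= /andP[ir ur] sep rel.
have cr : {in r, forall j, c j = 0}.
  move=> j jr; have ij : j != i by apply: contraNneq ir => <-.
  have [||y Py hy] := sep j i _ _ ij; rewrite ?inE ?jr ?eqxx ?orbT//.
  suff : c j * (chi j y - chi i y) = 0.
    by move/eqP; rewrite mulf_eq0 subr_eq0 (negbTE hy) orbF => /eqP.
  apply: (IH (fun j => c j * (chi j y - chi i y))) jr => // [k l kr lr|x Px].
    by apply: sep; rewrite inE ?kr ?lr orbT.
  have := rel _ (PD _ _ Px Py); rewrite big_cons chiD mulrA => e1.
  have := rel _ Px; rewrite big_cons => /(congr1 ( *%R^~ (chi i y))).
  rewrite mul0r mulrDl mulr_suml => e2.
  have := congr2 (fun a b => a - b) e1 e2.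
  rewrite subrr opprD addrACA subrr add0r -sumrB => e; rewrite -[RHS]e.
  by apply: eq_bigr => k _; rewrite chiD; ring.
move=> j; rewrite inE => /orP[/eqP->|/cr//].
have := rel _ P0; rewrite big_cons chi0 mulr1 big_seq big1 ?addr0// => k kr.
by rewrite cr// mul0r.
Qed.

End CharacterIndependence.

(** * Rescaled root systems *)

Section Rescaling.
Variables (R : realType) (V : vectType R) (form : {dot V for idfun}).
Variables (R0 : {fset V}) (k : V -> R).
Hypothesis hR0 : root_system form R0.
Hypothesis k_gt0 : forall a, a \in R0 -> 0 < k a.
Hypothesis k_refl : forall a b, a \in R0 -> b \in R0 -> k (reflection form a b) = k b.
Hypothesis k_int : forall a b, a \in R0 -> b \in R0 ->
  k a / k b * form a (coroot form b) \is a Num.int.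
Implicit Types (a b x : V).
Local Notation s := (reflection form).
Local Notation co := (coroot form).
Local Notation W := (weyl_group form R0).

(** Common form of the two hats: k a = 2 / <a, a> yields the dual roots, a constant k a homothetic
    copy. *)
Definition rescaled (A : {fset V}) : {fset V} := [fset k a *: a | a in A]%fset.

Lemma rescaledP (A : {fset V}) x :
  reflect (exists2 a, a \in A & x = k a *: a) (x \in rescaled A).
Proof. by apply: (iffP (imfsetP _ _ _ _)) => -[a aA e]; exists a. Qed.

Lemma rescaled_mem (A : {fset V}) a : a \in A -> k a *: a \in rescaled A.
Proof. by move=> aA; apply/rescaledP; exists a. Qed.

Lemma k_neq0 a : a \in R0 -> k a != 0.
Proof. by move=> /k_gt0/lt0r_neq0. Qed.

Lemma kN a : a \in R0 -> k (- a) = k a.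
Proof. by move=> aR; rewrite -(reflection_self form) k_refl. Qed.

Lemma k_weyl w a : W w -> a \in R0 -> k (w a) = k a.
Proof.
move=> hw aR; elim: hw => [|b v bR hv IH]; first by rewrite id_lfunE.
by rewrite comp_lfunE k_refl// (weyl_root hR0).
Qed.

Lemma rescaled_reflection a x : a \in R0 -> s (k a *: a) x = s a x.
Proof. by move=> /k_neq0; exact: reflection_scale. Qed.

Lemma rescaled_int a b : form (k a *: a) (co (k b *: b)) = k a / k b * form a (co b).
Proof. by rewrite coroot_scale dotZl [form _ (_^-1 *: _)]dotZr mulrA. Qed.

Lemma rescaled_inj : {in R0 &, injective (fun a => k a *: a)}.
Proof.
move=> a b aR bR e; have ka := k_gt0 aR; have kb := k_gt0 bR.
have e' : b = (k a / k b) *: a.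
  by rewrite mulrC -scalerA e scalerA mulVf ?scale1r// k_neq0.
have := bR; rewrite {1}e' => /(root_reduced hR0 aR)[] h; last first.
  by have := divr_gt0 ka kb; rewrite h oppr_gt0 ltr10.
by rewrite e' h scale1r.
Qed.

Lemma rescaled_root_system : root_system form (rescaled R0).
Proof.
split.
- by move=> _ /rescaledP[a aR ->]; rewrite scaler_eq0 negb_or k_neq0// (root_neq0 hR0).
- apply/eqP; rewrite eqEsubv subvf -(root_span hR0); apply/span_subvP => a aR.
  rewrite (_ : a = (k a)^-1 *: (k a *: a)); last first.
    by rewrite scalerA mulVf ?scale1r// k_neq0.
  exact/rpredZ/memv_span/rescaled_mem.
- move=> _ _ /rescaledP[a aR ->] /rescaledP[b bR ->].
  rewrite rescaled_reflection// linearZ/= -(k_refl aR bR).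
  exact/rescaled_mem/(root_refl hR0).
- by move=> _ _ /rescaledP[a aR ->] /rescaledP[b bR ->]; rewrite rescaled_int k_int.
- move=> _ m /rescaledP[a aR ->] /rescaledP[b bR e].
  have e' : b = (m * k a / k b) *: a.
    by rewrite mulrC -!scalerA e scalerA mulVf ?scale1r// k_neq0.
  have kab : k b = k a.
    have := bR; rewrite {1}e' => /(root_reduced hR0 aR)[] h; rewrite e' h.
      by rewrite scale1r.
    by rewrite scaleN1r kN.
  have := bR; rewrite {1}e' kab mulfK ?k_neq0//.
  exact: (root_reduced hR0 aR).
Qed.

Lemma rescaled_irreducible : irreducible_roots form R0 ->
  irreducible_roots form (rescaled R0).
Proof.
move=> [/fset0Pn[a0 a0R] irr]; split.
  by apply/fset0Pn; exists (k a0 *: a0); exact: rescaled_mem.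
move=> A /fsubsetP sA /fset0Pn[x xA] AS.
pose B := [fset a in R0 | k a *: a \in A]%fset.
have [|||a [b [aB bB ab]]] := irr B.
- by apply/fsubsetP => a; rewrite !inE => /andP[].
- have /rescaledP[a aR e] := sA _ xA.
  by apply/fset0Pn; exists a; rewrite !inE aR -e.
- apply: contra_neq AS => BR; apply/fsetP => y; apply/idP/idP; first exact: sA.
  by move=> /rescaledP[a aR ->]; move: aR; rewrite -BR !inE => /andP[].
move: aB; rewrite !inE => /andP[aR aA].
move: bB; rewrite !inE => /andP[]; rewrite negb_and => /orP[/negbTE->//|bA] bR.
exists (k a *: a), (k b *: b); rewrite !inE bA rescaled_mem//; split=> //.
by rewrite dotZl dotZr !mulf_neq0// k_neq0.
Qed.

Variable u : V.
Hypothesis hu : forall a, a \in R0 -> form a u != 0.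

Lemma rescaled_regular a : a \in rescaled R0 -> form a u != 0.
Proof.
by move=> /rescaledP[b bR ->]; rewrite dotZl mulf_neq0 ?hu// k_neq0.
Qed.

Lemma rescaled_pos : rescaled (pos_roots form R0 u) = pos_roots form (rescaled R0) u.
Proof.
apply/fsetP => x; rewrite posE; apply/rescaledP/andP => [[a]|[/rescaledP[a aR ->]]].
  rewrite posE => /andP[aR au] ->; rewrite rescaled_mem// dotZl.
  by rewrite mulr_gt0// k_gt0.
by rewrite dotZl pmulr_rgt0 ?k_gt0// => au; exists a => //; rewrite posE aR.
Qed.

Lemma rescaled_dominant x :
  dominant form (rescaled R0) u x <-> dominant form R0 u x.
Proof.
rewrite /dominant -rescaled_pos; split=> [h a aR|h _ /rescaledP[a aR ->]].
  have := h _ (rescaled_mem aR); rewrite dotZr pmulr_rge0// k_gt0//.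
  exact: pos_root aR.
by rewrite dotZr mulr_ge0 ?h// ltW// k_gt0// (pos_root aR).
Qed.

Lemma rescaled_in_cone x :
  in_cone form (rescaled R0) u x <-> in_cone form R0 u x.
Proof. by split=> h z /rescaled_dominant; exact: h. Qed.

End Rescaling.

(** * Sums and products of even terms over positive roots *)

Section PositiveReindexing.
Variables (R : realType) (V : vectType R) (form : {dot V for idfun}).
Variables (R0 : {fset V}) (u : V).
Hypothesis hR0 : root_system form R0.
Hypothesis hu : forall a, a \in R0 -> form a u != 0.
Local Notation Rp := (pos_roots form R0 u).
Local Notation W := (weyl_group form R0).

Definition pos_part (a : V) : V := if a \in Rp then a else - a.

Lemma pos_part_pos a : a \in R0 -> pos_part a \in Rp.
Proof.
by move=> aR; rewrite /pos_part; case: ifPn => // /(npos_opp hR0 hu aR).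
Qed.

Lemma pos_part_perm w : W w -> perm_eq [seq pos_part (w a) | a <- Rp] Rp.
Proof.
move=> hw; have Rpu : uniq Rp by exact: fset_uniq.
have ui : uniq [seq pos_part (w a) | a <- Rp].
  rewrite map_inj_in_uniq// => a b aR bR; rewrite /pos_part.
  have h x y : x \in Rp -> y \in Rp -> w x = - w y -> x = y.
    move=> xR yR; rewrite -linearN => /(weyl_inj hw) e.
    by have := pos_opp yR; rewrite -e xR.
  case: ifP => _; case: ifP => _.
  - exact: weyl_inj hw _ _.
  - by move=> /h; apply.
  - by move=> /esym/h e; apply/esym/e.
  - by move=> /oppr_inj; exact: weyl_inj hw _ _.
have sub : {subset [seq pos_part (w a) | a <- Rp] <= Rp}.
  move=> x /mapP[a aR ->]; apply: pos_part_pos.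
  exact: (weyl_root hR0 hw (pos_root aR)).
have [|_ eqi] := uniq_min_size ui sub; first by rewrite size_map.
exact: uniq_perm.
Qed.

(** A Weyl group element permutes the pairs {a, -a}, each of which contains exactly one positive
    root. *)
Lemma even_reindex (T : Type) (idx : T) (op : Monoid.com_law idx) (f : V -> T) w :
  W w -> (forall a, a \in R0 -> f (- a) = f a) ->
  \big[op/idx]_(a <- Rp) f (w a) = \big[op/idx]_(a <- Rp) f a.
Proof.
move=> hw fN; rewrite -[RHS](perm_big _ (pos_part_perm hw)) big_map.
apply: eq_big_seq => a aR; rewrite /pos_part; case: ifP => // _.
by rewrite fN// (weyl_root hR0 hw (pos_root aR)).
Qed.

End PositiveReindexing.

(** * The gradient of the potential and the location of its zeros *)

Section BetheEquations.
Variables (R : realType) (V : vectType R) (form : {dot V for idfun}).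
Implicit Types (a b x y z mu xi : V).
Local Notation s := (reflection form).
Local Notation co := (coroot form).

(* [k a *: a] plays the role of \hat a; [g] is the root whose hat is the
   highest root of \hat R_0. *)
Record affine_datum (R0 : {fset V}) (u : V) (k : V -> R) (g : V) (t : V -> R) :
    Prop := AffineDatum {
  datum_roots : root_system form R0;
  datum_regular : forall a, a \in R0 -> form a u != 0;
  datum_k_gt0 : forall a, a \in R0 -> 0 < k a;
  datum_k_refl : forall a b, a \in R0 -> b \in R0 -> k (s a b) = k b;
  datum_k_int : forall a b, a \in R0 -> b \in R0 ->
    k a / k b * form a (co b) \is a Num.int;
  datum_g : g \in pos_roots form R0 u;
  datum_kg : k g *: g = co g;
  datum_highest : forall a, a \in pos_roots form R0 u ->
    in_cone form R0 u (k g *: g - k a *: a);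
  datum_t : forall a, a \in R0 -> -1 < t a < 1;
  datum_t_refl : forall a b, a \in R0 -> b \in R0 -> t (s a b) = t b }.

Variables (R0 : {fset V}) (u : V) (k : V -> R) (g : V) (t : V -> R).
Hypothesis hD : affine_datum R0 u k g t.
Local Notation Rp := (pos_roots form R0 u).
Local Notation W := (weyl_group form R0).
Let hR0 := datum_roots hD.
Let hu := datum_regular hD.
Let k_gt0 := datum_k_gt0 hD.
Let k_refl := datum_k_refl hD.
Let t_refl := datum_t_refl hD.

Lemma t_weyl w a : W w -> a \in R0 -> t (w a) = t a.
Proof.
move=> hw aR; elim: hw => [|b v bR hv IH]; first by rewrite id_lfunE.
by rewrite comp_lfunE t_refl// (weyl_root hR0).
Qed.

Lemma tN a : a \in R0 -> t (- a) = t a.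
Proof. by move=> aR; rewrite -(reflection_self form) t_refl. Qed.

Variable c : R.
Hypothesis c_gt0 : 0 < c.

(* The gradient of the potential of [mu] at [x] is
   [bethe_grad x - 2 pi (hat_weyl_vector + mu)]. *)
Definition bethe_grad x : V :=
  c *: x + \sum_(b <- Rp) (k b * bethe_fun (t b) (form x b)) *: b.

Definition hat_weyl_vector : V := 2^-1 *: \sum_(b <- Rp) k b *: b.

Local Notation G := bethe_grad.
Local Notation rho := hat_weyl_vector.

Lemma dot_bethe_grad x y : form (G x) y =
  c * form x y + \sum_(b <- Rp) k b * bethe_fun (t b) (form x b) * form b y.
Proof.
rewrite /G dotDl dotZl dot_suml; congr (_ + _).
by apply: eq_bigr => b _; rewrite dotZl.
Qed.

(** The linear term alone accounts for the bound; the others contribute nonnegatively because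
    [bethe_fun] is nondecreasing. *)
Lemma bethe_grad_mono x y : c * form (x - y) (x - y) <= form (G x - G y) (x - y).
Proof.
rewrite [in leRHS]dotBl !dot_bethe_grad opprD addrACA -sumrB -mulrBr -dotBl lerDl.
rewrite big_seq sumr_ge0// => b bR; have bR0 := pos_root bR.
have [L _ /(_ (form x b) (form y b))[m /andP[m0 _] e]] :=
  bethe_fun_slope (datum_t hD bR0).
rewrite -mulrBl -mulrBr e -dotBl (dotC _ b) -mulrA.
apply: mulr_ge0; first exact/ltW/k_gt0.
by rewrite -mulrA mulr_ge0// -expr2 sqr_ge0.
Qed.

Lemma bethe_grad_weyl w x : W w -> G (w x) = w (G x).
Proof.
move=> hw; rewrite /G linearD linearZ linear_sum /=; congr (_ + _).
pose f b := (k b * bethe_fun (t b) (form (w x) b)) *: b.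
rewrite -(even_reindex hR0 hu _ (f := f) hw) => [|a aR].
  apply: eq_big_seq => b /pos_root bR; rewrite linearZ/= /f.
  by rewrite (k_weyl hR0 k_refl)// t_weyl// (weyl_isometric hw).
rewrite /f (kN k_refl)// tN// dotNr bethe_funN ?mulrN ?scalerN ?scaleNr ?opprK//.
Qed.

Lemma bethe_grad_refl a x : a \in R0 -> G (s a x) = s a (G x).
Proof. by move=> aR; apply: bethe_grad_weyl; exact: weyl_refl. Qed.

(** The nonlinear part of [bethe_grad] with [bethe_fun] replaced by the identity. As [bethe_fun] is
    quasi-periodic, this is how that part changes under translation by 2 pi times a coroot. *)
Definition poisson_sum x : V := \sum_(b <- Rp) (k b * form x b) *: b.

Lemma bethe_grad_coroot x a : a \in R0 ->
  G (x + (2 * pi) *: co a) =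
  G x + (2 * pi) *: (c *: co a + poisson_sum (co a)).
Proof.
move=> aR; rewrite /G [in LHS]scalerDr [in RHS]scalerDr.
have -> : c *: ((2 * pi) *: co a) = (2 * pi) *: (c *: co a).
  by rewrite !scalerA [c * _]mulrC.
rewrite -!addrA; congr (_ + _); rewrite [in RHS]addrCA; congr (_ + _).
rewrite /poisson_sum scaler_sumr -big_split/=; apply: eq_big_seq => b /pos_root bR.
have /intrP[m e] := root_integral hR0 aR bR.
rewrite dotDl (dotZl form (2 * pi) (co a)) (dotC form (co a)) e.
rewrite bethe_fun_periodic ?(datum_t hD)//.
by rewrite mulrDr scalerDl scalerA; congr (_ + _ *: _); ring.
Qed.

(** For simple [a] the reflection s_a permutes the other positive roots, so the rest [S] of the sum
    is fixed by s_a and orthogonal to [a]. *)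
Lemma hat_weyl_vector_gt0 a : a \in Rp -> 0 < form rho a.
Proof.
move: a; apply: simple_ind => [a sa|a b _ _]; last first.
  by rewrite dotDr; exact: addr_gt0.
have aRp := simple_pos sa; have aR := pos_root aRp.
pose S := \sum_(b <- Rp | b != a) k b *: b.
have rhoE : rho = 2^-1 *: (k a *: a + S).
  by rewrite /rho (bigD1_seq a) ?fset_uniq.
have eS : s a S = S.
  rewrite /S linear_sum/= -[RHS]big_filter -big_filter.
  rewrite -[RHS](perm_big _ (simple_refl_perm hR0 hu sa)) big_map.
  apply: eq_big_seq => b; rewrite mem_filter => /andP[_ /pos_root bR].
  by rewrite linearZ/= k_refl.
have := reflection_sym form a S a; rewrite eS reflection_self dotNr => e0.
rewrite rhoE dotZl dotDl dotZl.
have := mulr_gt0 (k_gt0 aR) (root_dot_gt0 hR0 aR); lra.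
Qed.

(** With m = <b, a^v>, the terms of b on the two sides are m and m^2 times the same positive factor.
    An integer satisfies m <= m^2, strictly for b = a, where m = 2. *)
Lemma hat_weyl_vector_lt a : a \in Rp ->
  2 * form rho a < form (poisson_sum (co a)) a.
Proof.
move=> aRp; have aR := pos_root aRp.
rewrite /rho /poisson_sum dotZl mulVKf ?pnatr_eq0// !dot_suml.
have aa := root_dot_gt0 hR0 aR.
have term b : b \in Rp ->
    form (k b *: b) a <= form ((k b * form (co a) b) *: b) a.
  move=> /pos_root bR; have /intrP[m e] := root_integral hR0 aR bR.
  rewrite (dotC form (co a)) !dotZl -mulrA ler_pM2l ?k_gt0// e.
  have -> : form b a = m%:~R * form a a / 2.
    by rewrite -e dot_coroot; field; rewrite lt0r_neq0.
  have m2 : m%:~R <= m%:~R * m%:~R :> R by rewrite -intrM ler_int; nia.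
  by have := ler_pM2r aa; nra.
rewrite (big_rem a)//= [ltRHS](big_rem a)//=; apply: ltr_leD.
  rewrite (dotC form (co a)) !dotZl -mulrA ltr_pM2l ?k_gt0//.
  by rewrite (dot_coroot_self form (root_neq0 hR0 aR)); lra.
rewrite big_seq [leRHS]big_seq; apply: ler_sum => b /mem_rem; exact: term.
Qed.

Variables (mu xi : V).
Hypothesis hmu : forall a, a \in Rp -> 0 <= form mu a <= c.
Hypothesis hxi : G xi = (2 * pi) *: (rho + mu).

(* Compare [xi] with its mirror images in the walls [<., a> = 0] and
   [<., a> = 2 pi], using the strong monotonicity and the equivariance of
   the gradient. *)
Lemma bethe_node_alcove a : a \in Rp -> 0 < form xi a < 2 * pi.
Proof.
move=> aRp; have aR := pos_root aRp; have aa := root_dot_gt0 hR0 aR.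
have p0 : 0 < pi :> R by exact: pi_gt0.
have /andP[mu0 muc] := hmu aRp; have rho0 := hat_weyl_vector_gt0 aRp.
have rhoc := hat_weyl_vector_lt aRp.
have Ga : form (G xi) a = 2 * pi * (form rho a + form mu a).
  by rewrite hxi dotZl dotDl.
(* Strong monotonicity along the direction of [a]: the displacement [p] and the increment [q] of the
   gradient have the same sign. *)
have key (p q : R) y : xi - y = p *: a -> form (G xi - G y) a = q ->
    q != 0 -> 0 < p * q.
  move=> e1 e2 q0; have := bethe_grad_mono xi y; rewrite e1 !(dotZr form p) (dotZl form p) e2 => h.
  have pn0 : p != 0.
    apply: contraNneq q0 => p0'; rewrite -e2.
    have /eqP : xi - y = 0 by rewrite e1 p0' scale0r.
    by rewrite subr_eq0 => /eqP ->; rewrite subrr dot0l.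
  apply: lt_le_trans h; rewrite mulr_gt0// mulrA mulr_gt0// -expr2.
  by rewrite exprn_even_gt0.
apply/andP; split.
  have Ga0 : 0 < 2 * form (G xi) a.
    by rewrite Ga !mulr_gt0// ltr_pwDl.
  have e1 y : y - s a y = form y (co a) *: a.
    by rewrite reflectionE opprB addrC subrK.
  have := key _ _ _ (e1 xi) erefl; rewrite bethe_grad_refl// e1 dotZl dot_coroot.
  rewrite (divfK (lt0r_neq0 aa)) => /(_ (lt0r_neq0 Ga0)).
  by rewrite dot_coroot pmulr_lgt0// pmulr_lgt0 ?invr_gt0// pmulr_rgt0.
(* The increment of the gradient from the mirror image in the upper wall to [xi]. It is negative by
   [hat_weyl_vector_lt] and <mu, a> <= c. *)
pose q := 2 * form (G xi) a - 2 * pi * (2 * c + form (poisson_sum (co a)) a).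
have q0 : q < 0 by rewrite /q Ga; nra.
have := key ((form xi a - 2 * pi) * (2 / form a a)) q (s a xi + (2 * pi) *: co a).
have -> : xi - (s a xi + (2 * pi) *: co a) =
    ((form xi a - 2 * pi) * (2 / form a a)) *: a.
  rewrite reflectionE opprD opprB addrA [xi + _]addrC subrK /coroot scalerA.
  by rewrite -scalerBl dotZr; congr (_ *: _); ring.
have -> : form (G xi - G (s a xi + (2 * pi) *: co a)) a = q.
  rewrite bethe_grad_coroot// bethe_grad_refl// dotBl (dotDl form (s a _)).
  rewrite (dotZl form (2 * pi)) (dotDl form (c *: co a)) (dotZl form c).
  rewrite (dotC form (co a)).
  rewrite (dot_coroot_self form (root_neq0 hR0 aR)) reflection_sym reflection_self.
  by rewrite dotNr /q; ring.
move=> /(_ erefl erefl (ltr0_neq0 q0)).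
rewrite nmulr_lgt0// pmulr_llt0; first by rewrite subr_lt0.
by rewrite divr_gt0.
Qed.

End BetheEquations.

Section IntegerBounds.
Variable R : realType.
Implicit Type m : int.

Lemma intr_lt0 m : m < 0 -> m%:~R <= -1 :> R.
Proof. by rewrite -[-1](mulrN1z 1) ler_int; lia. Qed.

Lemma intr_gt1 m : 1 < m -> 2 <= m%:~R :> R.
Proof. by rewrite (_ : 2 = 2%:~R)// ler_int; lia. Qed.

Lemma intr_01 m : 0 <= m -> m <= 1 -> (m%:~R == 0 :> R) || (m%:~R == 1 :> R).
Proof. by rewrite !(eqr_int _ _ 0, eqr_int _ _ 1); lia. Qed.

End IntegerBounds.

(** * Wall relations for C and for the Weyl group sums *)

Section Walls.
Variables (R : realType) (V : vectType R) (form : {dot V for idfun}).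
Implicit Types (a b x y z mu xi eta kappa : V).
Local Notation s := (reflection form).
Local Notation co := (coroot form).
Variables (R0 : {fset V}) (u : V) (k : V -> R) (g : V) (t : V -> R).
Hypothesis hD : affine_datum form R0 u k g t.
Local Notation Rp := (pos_roots form R0 u).
Local Notation W := (weyl_group form R0).
Local Notation C := (macdonald_C form Rp t).
Let hR0 := datum_roots hD.
Let hu := datum_regular hD.
Let k_gt0 := datum_k_gt0 hD.
Let k_refl := datum_k_refl hD.
Let t_refl := datum_t_refl hD.
Let gRp := datum_g hD.
Let kg := datum_kg hD.

(** The Cartan integer of hat b against the highest rescaled root hat g: since hat g is the coroot
    of [g], its own coroot is [g]. *)
Local Notation n b := (k b * form b g).

Lemma pairing_int b : b \in R0 -> n b \is a Num.int.
Proof.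
move=> bR; have gR := pos_root gRp; have := datum_k_int hD bR gR.
by rewrite -kg dotZr mulrA divfK// lt0r_neq0// k_gt0.
Qed.

Lemma pairing_g : n g = 2.
Proof. by rewrite -dotZr kg dot_coroot_self// (pos_neq0 hR0 gRp). Qed.

Lemma highest_reflection b : k b *: s g b = k b *: b - n b *: (k g *: g).
Proof.
rewrite reflectionE -{1}kg scalerBr dotZr !scalerA; congr (_ - _ *: _); ring.
Qed.

(** Reflection in g subtracts n(b) hat g from hat b. If n(b) < 0, the result is higher than hat g.
    If n(b) >= 2, its opposite is a positive root of height at least 2 ht(hat g) - ht(hat b), which
    is possible only if hat b = hat g. *)
Lemma highest_pairing b : b \in Rp -> b != g -> (n b == 0) || (n b == 1).
Proof.
move=> bRp bg; have bR := pos_root bRp; have gR := pos_root gRp.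
have hb := datum_highest hD bRp.
have sR : s g b \in R0 by exact: root_refl hR0 _ _ _ _.
have ks : k (s g b) = k b by exact: k_refl.
have kb := k_gt0 bR; have kg0 := k_gt0 gR.
have gu := mulr_gt0 kg0 (pos_gt0 gRp); have bu := mulr_gt0 kb (pos_gt0 bRp).
have su : k b * form (s g b) u = k b * form b u - n b * (k g * form g u).
  by rewrite -dotZl highest_reflection dotBl dotZl dotZl dotZl.
have le := in_cone_ge0 hb; rewrite dotBl !dotZl subr_ge0 in le.
have /intrP[m em] := pairing_int bR; rewrite em in su *.
have [m0|m0] := ltP m 0.
  have m1 : m%:~R <= -1 :> R by exact: intr_lt0.
  have sRp : s g b \in Rp.
    by rewrite posE sR -(pmulr_rgt0 _ kb) su; nra.
  by have := in_cone_ge0 (datum_highest hD sRp); rewrite ks dotBl !dotZl su; nra.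
have [m1|m1] := leP m 1.
  exact: intr_01.
have m2 : 2 <= m%:~R :> R by exact: intr_gt1.
have sN : k b * form (- s g b) u = m%:~R * (k g * form g u) - k b * form b u.
  by rewrite dotNl mulrN su opprB.
have sRp : - s g b \in Rp.
  by rewrite posE (root_oppE hR0) sR -(pmulr_rgt0 _ kb) sN; nra.
have := in_cone_ge0 (datum_highest hD sRp).
rewrite (kN k_refl)// ks dotBl !dotZl sN => h.
have /(in_cone_eq0 hb)/eqP : form (k g *: g - k b *: b) u = 0.
  by rewrite dotBl !dotZl; nra.
rewrite subr_eq0 => /eqP /(rescaled_inj hR0 k_gt0 gR bR) e.
by rewrite e eqxx in bg.
Qed.

Lemma highest_refl_pos b : b \in Rp -> (s g b \in Rp) = (n b == 0).
Proof.
move=> bRp; have bR := pos_root bRp; have kb := k_gt0 bR.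
have [->|bg] := eqVneq b g.
  by rewrite pairing_g reflection_self (negbTE (pos_opp gRp)) pnatr_eq0.
have [n0|n0] := eqVneq (n b) 0.
  have e : k b *: s g b = k b *: b.
    by rewrite highest_reflection n0 scale0r subr0.
  by rewrite (scalerI (lt0r_neq0 kb) e).
have := highest_pairing bRp bg; rewrite (negbTE n0)/= => /eqP n1.
apply/negbTE; rewrite posE negb_and -leNgt; apply/orP; right.
rewrite -(pmulr_rle0 _ kb) -dotZl highest_reflection n1 scale1r dotBl.
by have := in_cone_ge0 (datum_highest hD bRp); rewrite dotBl; lra.
Qed.

Definition regular eta := forall a, a \in R0 -> expi (form eta a) != 1.

Lemma regular_weyl w eta : W w -> regular eta -> regular (w eta).
Proof.
move=> hw h a aR; have [w' [hw' k1 k2]] := weyl_inv hw.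
by rewrite (weyl_adjoint _ _ hw k2) h// (weyl_root hR0).
Qed.

Lemma macdonald_C_neq0 eta : regular eta -> C eta != 0.
Proof.
move=> h; rewrite /macdonald_C prodf_seq_neq0; apply/allP => b /pos_root bR /=.
by apply: c_factor_neq0; [exact: datum_t hD _ _|exact: h].
Qed.

(* The rank-one relation that [C] satisfies across the wall
   [<., a^v> = tau]; for the affine wall it encodes the Bethe equation. *)
Definition wall_relation a (tau : R) eta :=
  C (s a eta) * expi (- (tau * form eta a)) *
    (1 - (t a)%:C%C * expi (- form eta a)) =
  - expi (- form eta a) * (1 - (t a)%:C%C * expi (form eta a)) * C eta.

(** The reflection permutes the factors of all positive roots except [a], so the relation reduces to
    an identity for a single factor. *)
Lemma simple_wall a eta : simple form R0 u a -> regular eta ->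
  wall_relation a 0 eta.
Proof.
move=> sa hr; have aRp := simple_pos sa; have aR := pos_root aRp.
rewrite /wall_relation mul0r oppr0 expi0 mulr1.
pose f b := c_factor (t b) (form eta b).
have CE y : C y = \prod_(b <- Rp) c_factor (t b) (form y b) by [].
have e : \prod_(b <- Rp | b != a) c_factor (t b) (form (s a eta) b) =
         \prod_(b <- Rp | b != a) f b.
  rewrite -[RHS]big_filter -big_filter.
  rewrite -[RHS](perm_big _ (simple_refl_perm hR0 hu sa)) big_map.
  apply: eq_big_seq => b; rewrite mem_filter => /andP[_ /pos_root bR].
  by rewrite /f t_refl// reflection_sym.
rewrite !CE (bigD1_seq a)//= ?fset_uniq// [in RHS](bigD1_seq a)//= ?fset_uniq//.
rewrite e reflection_sym reflection_self dotNr /c_factor opprK.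
set P := \prod_(_ <- _ | _) _; rewrite expiN.
have := hr a aR; have := expi_neq0 (form eta a).
set X := expi _ => X0 X1.
have h3 : 1 - X != 0 by rewrite subr_eq0 eq_sym.
have h4 : X - 1 != 0 by rewrite subr_eq0.
by field; rewrite X0 h3 h4.
Qed.

Variable c : R.

(** The gradient equation is paired with the inverse image of g under w, rewritten at the point w xi
    by evenness of the terms, and exponentiated. The factors [expi (- (pi * n b))] come from the
    half sum rho, while mu contributes an integral multiple of 2 pi. *)
Lemma bethe_equation mu xi w : W w ->
  (forall a, a \in R0 -> form mu (co (k a *: a)) \is a Num.int) ->
  bethe_grad form R0 u k t c xi =
    (2 * pi) *: (hat_weyl_vector form R0 u k + mu) ->
  expi (c * form (w xi) g) *
    \prod_(b <- Rp) (expi (n b * bethe_fun (t b) (form (w xi) b)) *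
      expi (- (pi * n b))) = 1.
Proof.
move=> hw hmu hxi; have [w' [hw' k1 k2]] := weyl_inv hw.
have gR := pos_root gRp; have w'gR : w' g \in R0 by exact: weyl_root hR0 _ _ hw' gR.
have expi_even (x : R) : x \is a Num.int -> expi (2 * pi * x) = 1.
  by move=> /intrP[m ->]; exact: expi_2pi.
have lhs : form (bethe_grad form R0 u k t c xi) (w' g) = c * form (w xi) g +
    \sum_(b <- Rp) n b * bethe_fun (t b) (form (w xi) b).
  rewrite dot_bethe_grad (weyl_adjoint _ _ hw k2); congr (_ + _).
  pose f b := n b * bethe_fun (t b) (form (w xi) b).
  rewrite -(even_reindex hR0 hu _ (f := f) hw) => [|a aR].
    apply: eq_big_seq => b /pos_root bR.
    rewrite /f (k_weyl hR0 k_refl)// (t_weyl hD)// (weyl_isometric hw).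
    by rewrite (weyl_adjoint _ _ hw k2); ring.
  by rewrite /f (kN k_refl)// (tN hD)// dotNl dotNr bethe_funN; ring.
have rhs : form (2 * pi *: (hat_weyl_vector form R0 u k + mu)) (w' g) =
    \sum_(b <- Rp) pi * n (w b) + 2 * pi * form mu (w' g).
  rewrite dotZl dotDl mulrDr; congr (_ + _).
  rewrite /hat_weyl_vector dotZl dot_suml mulrA (mulrAC 2) mulfV ?pnatr_eq0//.
  rewrite mul1r mulr_sumr; apply: eq_big_seq => b /pos_root bR.
  by rewrite dotZl (k_weyl hR0 k_refl)// (weyl_adjoint _ _ hw k2).
have muint : form mu (w' g) \is a Num.int.
  have := hmu _ w'gR; rewrite coroot_scale (k_weyl hR0 k_refl)//.
  rewrite (isometric_coroot _ (weyl_isometric hw')) -kg [w' (_ *: _)]linearZ/=.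
  by rewrite scalerA mulVf ?scale1r// lt0r_neq0// k_gt0.
rewrite big_split/= -expi_sum mulrA -expiD -lhs hxi rhs expiD expi_sum.
rewrite (even_reindex hR0 hu (f := fun b => expi (pi * n b)) _ hw) => [|a aR].
  rewrite expi_even// mulr1 -big_split/= big1// => b _.
  by rewrite -expiD addrN expi0.
rewrite (kN k_refl)// dotNl mulrN.
rewrite (_ : pi * n a = - (pi * n a) + 2 * pi * n a); last by ring.
by rewrite mulrN expiD expi_even ?pairing_int// mulr1.
Qed.

(** The reflection s_g reverses exactly the positive b with n(b) nonzero. For b other than g the
    resulting factor of C(s_g eta) / C(eta) is the inverse of the b-factor of the Bethe equation; g
    itself occurs once in the quotient but with exponent 2 in the equation. The surplus phase of g
    produces the factors with t_g in the relation. *)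
Lemma affine_wall mu xi w : W w -> regular xi ->
  (forall a, a \in R0 -> form mu (co (k a *: a)) \is a Num.int) ->
  bethe_grad form R0 u k t c xi =
    (2 * pi) *: (hat_weyl_vector form R0 u k + mu) ->
  wall_relation (- g) (- c) (w xi).
Proof.
move=> hw hr hmu hxi; have := bethe_equation hw hmu hxi.
have {}hr := regular_weyl hw hr; move: hr; set eta := w xi => hr beq.
have gR := pos_root gRp; have tg := datum_t hD gR.
rewrite /wall_relation reflectionN (tN hD)// !dotNr opprK mulrNN.
pose f b := c_factor (t b) (form eta b).
pose h b := if s g b \in Rp then f b else f (- b).
have Cs : C (s g eta) = \prod_(b <- Rp) h b.
  rewrite -(perm_big _ (pos_part_perm hR0 hu (@weyl_refl _ _ form _ _ gR))) big_map.
  apply: eq_big_seq => b bRp; have bR := pos_root bRp.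
  rewrite -[LHS]/(c_factor (t b) (form (s g eta) b)).
  have -> : c_factor (t b) (form (s g eta) b) = f (s g b).
    by rewrite /f t_refl// reflection_sym.
  rewrite /pos_part; case: ifPn => sb; rewrite /h; first by rewrite reflectionK bRp.
  by rewrite [s g (- _)]linearN/= reflectionK (negbTE (pos_opp bRp)) opprK.
pose E b := expi (bethe_fun (t b) (form eta b)).
have E0 b : E b != 0 by exact: expi_neq0.
have fN b : b \in Rp -> f (- b) = - (E b)^-1 * f b.
  move=> bRp; have bR := pos_root bRp.
  by rewrite /f (tN hD)// dotNr c_factorN ?(datum_t hD) ?hr// expiN.
pose r b := if s g b \in Rp then 1 else - (E b)^-1.
have CsE : C (s g eta) = (\prod_(b <- Rp) r b) * C eta.
  rewrite Cs -big_split/=; apply: eq_big_seq => b bRp.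
  by rewrite /h /r fN//; case: ifP => _; rewrite ?mul1r.
have expi_pi : expi (- pi) = -1 :> R[i].
  by apply/eqP; rewrite /expi cosN sinN cospi sinpi eq_complex/= !eqxx.
have rE : \prod_(b <- Rp) r b = - E g * expi (c * form eta g).
  have -> : - E g * expi (c * form eta g) = - E g * expi (c * form eta g) *
      (expi (c * form eta g) * \prod_(b <- Rp) (expi (n b *
      bethe_fun (t b) (form eta b)) * expi (- (pi * n b))))^-1.
    by rewrite beq invr1 mulr1.
  rewrite invfM mulrA mulfK ?expi_neq0//.
  rewrite (bigD1_seq g)//= ?fset_uniq// [in RHS](bigD1_seq g)//= ?fset_uniq//.
  have -> : \prod_(b <- Rp | b != g) (expi (n b *
      bethe_fun (t b) (form eta b)) * expi (- (pi * n b))) =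
      (\prod_(b <- Rp | b != g) r b)^-1.
    rewrite -prodfV big_seq_cond [RHS]big_seq_cond; apply: eq_bigr => b /andP[bRp bg].
    rewrite /r highest_refl_pos//; have /orP[/eqP->|/eqP->] := highest_pairing bRp bg.
      by rewrite eqxx invr1 mul0r mulr0 oppr0 expi0 mulr1.
    by rewrite oner_eq0 invrN invrK mul1r mulr1 expi_pi mulrN1.
  rewrite invfM invrK [RHS]mulrA; congr (_ * _).
  rewrite /r highest_refl_pos// pairing_g pnatr_eq0/=.
  rewrite mulr_natr mulr_natl !mulr2n opprD (expiD (bethe_fun _ _)) (expiD (- pi)) -/(E g) expi_pi.
  by field; exact: E0.
rewrite CsE rE /E expi_bethe_fun// !expiN.
have := one_sub_expi_neq0 (form eta g) tg.
have := expi_neq0 (form eta g); set X := expi (form eta g).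
have := expi_neq0 (c * form eta g); set Y := expi (c * _) => Y0 X0 h0.
by field; rewrite Y0 X0 h0.
Qed.

Variables (ws : seq 'End(V)).
Hypothesis ws_uniq : uniq ws.
Hypothesis wsP : forall w, w \in ws <-> W w.

Definition weyl_sum kappa xi : R[i] :=
  \sum_(v <- ws) C (v xi) * expi (form (v xi) kappa).

(** The point kappa + m a is the mirror image of kappa in the wall. By the wall relation the summand
    [H] changes sign under s_a, so its sum over the Weyl group vanishes; expanding [H] gives the
    four terms. *)
Lemma weyl_sum_relation a (tau : R) kappa xi : a \in R0 ->
  (forall w, W w -> wall_relation a tau (w xi)) ->
  let m := tau - form kappa (co a) in
  weyl_sum kappa xi + weyl_sum (kappa + (m - 1) *: a) xi =
  (t a)%:C%C * (weyl_sum (kappa + m *: a) xi + weyl_sum (kappa + a) xi).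
Proof.
move=> aR hw m.
pose H eta := C eta * (1 - (t a)%:C%C * expi (form eta a)) *
  (expi (form eta kappa) + expi (form eta (kappa + (m - 1) *: a))).
suff h : \sum_(v <- ws) H (v xi) = 0.
  apply/eqP; rewrite -subr_eq0 -h; apply/eqP.
  rewrite /weyl_sum mulrDr !mulr_sumr -!big_split/= -sumrB; apply: eq_bigr => v _.
  rewrite /H !dotDr !dotZr mulrBl mul1r !expiD.
  rewrite expiN; have := expi_neq0 (form (v xi) a); set X := expi _ => X0.
  by field.
have anti v : v \in ws -> H (s a (v xi)) = - H (v xi).
  move=> /wsP/hw; set eta := v xi; rewrite /wall_relation => e.
  rewrite /H !(reflection_sym form a eta) linearD linearZ/= reflection_self.
  rewrite (reflectionE form a kappa) !(dotDr form) !(dotZr form (m - 1)) !dotNr.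
  rewrite (dotZr form (form kappa (co a))).
  set x := form eta a in e *; set K := form eta kappa; set q := form kappa (co a).
  have -> : K - q * x = - (tau * x) + (x + (K + (m - 1) * x)) by rewrite /m; ring.
  have -> : - (tau * x) + (x + (K + (m - 1) * x)) + (m - 1) * - x =
    - (tau * x) + (x + K) by ring.
  rewrite !expiD.
  transitivity ((C (s a eta) * expi (- (tau * x)) * (1 - (t a)%:C%C * expi (- x))) *
    (expi x * (expi K * expi ((m - 1) * x) + expi K))); first by ring.
  by rewrite e expiN; have := expi_neq0 x; set X := expi x => X0; field.
have pr : perm_eq [seq (s a \o v)%VF | v <- ws] ws.
  have uni : uniq [seq (s a \o v)%VF | v <- ws].
    rewrite map_inj_uniq// => v1 v2 /lfunP e; apply/lfunP => x.
    by have := e x; rewrite !comp_lfunE => /(can_inj (reflectionK form a)).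
  have sub : {subset [seq (s a \o v)%VF | v <- ws] <= ws}.
    by move=> _ /mapP[v /wsP hv ->]; apply/wsP; exact: weyl_reflection.
  have [|_ eqi] := uniq_min_size uni sub; first by rewrite size_map.
  exact: uniq_perm.
have e : \sum_(v <- ws) H (v xi) = - \sum_(v <- ws) H (v xi).
  rewrite -[LHS](perm_big _ pr) big_map -sumrN; apply: eq_big_seq => v vw.
  by rewrite comp_lfunE anti.
apply/eqP; move/eqP: e; rewrite -addr_eq0 -mulr2n -mulr_natl mulf_eq0.
by rewrite pnatr_eq0.
Qed.

End Walls.

(** * Propagation of vanishing from the alcove to all weights *)

Section Straightening.
Variables (R : realType) (V : vectType R) (form : {dot V for idfun}).
Implicit Types (a b x y z mu xi eta kappa p : V).
Local Notation s := (reflection form).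
Local Notation co := (coroot form).
Variables (R0 : {fset V}) (u : V) (k : V -> R) (g : V) (t : V -> R).
Hypothesis hD : affine_datum form R0 u k g t.
Local Notation Rp := (pos_roots form R0 u).
Local Notation W := (weyl_group form R0).
Local Notation P := (weight_lattice form R0).
Let hR0 := datum_roots hD.
Let hu := datum_regular hD.
Let k_gt0 := datum_k_gt0 hD.
Let gRp := datum_g hD.
Let kg := datum_kg hD.
Variable c : nat.
Hypothesis c_gt0 : (0 < c)%N.
Variable Phi : V -> R[i].

Definition straightening_relation a (tau : R) kappa :=
  let m := tau - form kappa (co a) in
  Phi kappa + Phi (kappa + (m - 1) *: a) =
  (t a)%:C%C * (Phi (kappa + m *: a) + Phi (kappa + a)).

Definition in_alcove kappa :=
  P kappa /\ forall b, b \in Rp -> 0 <= form kappa (k b *: b) <= c%:R.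

Lemma weightD_root kappa a (m : R) : P kappa -> a \in R0 -> m \is a Num.int ->
  P (kappa + m *: a).
Proof.
move=> hk aR hm b bR; rewrite dotDl dotZl rpredD ?rpredM//; first exact: hk.
exact: (root_integral hR0).
Qed.

(* The reflected point and the points strictly between [kappa] and it are
   closer to [p] than [kappa], by a fixed amount. *)
Lemma straighten_step a (tau e : R) p kappa : a \in R0 -> tau \is a Num.int ->
  e <= form a a * (form p (co a) - tau) -> form kappa (co a) < tau ->
  P kappa -> 0 < e ->
  (forall x, P x ->
    form (x - p) (x - p) <= form (kappa - p) (kappa - p) - e -> Phi x = 0) ->
  straightening_relation a tau kappa -> Phi kappa = 0.
Proof.
move=> aR taui he ktau Pk e0 IH; have aa := root_dot_gt0 hR0 aR.
rewrite /straightening_relation; set m := tau - form kappa (co a).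
have mi : m \is a Num.int by rewrite rpredB//; exact: Pk.
have m0 : 0 < m by rewrite subr_gt0.
have m1 : 1 <= m by have /intrP[n en] := mi; move: m0; rewrite en ltr0z ler1z; lia.
have zero (j : R) : j \is a Num.int -> 1 <= j <= m -> Phi (kappa + j *: a) = 0.
  move=> ji /andP[j1 jm]; apply: IH; first exact: weightD_root.
  rewrite addrAC; set y := kappa - p.
  have ya : 2 * form y a = form a a * (tau - m - form p (co a)).
    rewrite (_ : tau - m = form kappa (co a)); last by rewrite /m; ring.
    by rewrite -dotBl dot_coroot [RHS]mulrC divfK// lt0r_neq0.
  rewrite (dotDl form y) !(dotDr form y) !(dotZl form j) !(dotZr form j) (dotC form a y).
  have jmj : 0 <= form a a * (j * (m - j)).
    by rewrite mulr_ge0 ?(ltW aa)// mulr_ge0 ?subr_ge0//; lra.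
  have h1 : e <= j * (form a a * (form p (co a) - tau)).
    by apply: (le_trans he); rewrite ler_peMl//; exact: le_trans (ltW e0) he.
  nra.
rewrite (zero m)//; last by rewrite m1 lexx.
rewrite -{3}[a]scale1r (zero 1) ?rpred1//; last by rewrite m1 lexx.
(* For m = 1 the second term of the relation is [Phi kappa] again, and the relation reads 2 Phi
   kappa = 0. *)
rewrite addr0 mulr0; have [->|m1'] := eqVneq m 1.
  by rewrite subrr scale0r addr0 => /eqP; rewrite -mulr2n mulrn_eq0 => /eqP.
rewrite (zero (m - 1)) ?addr0//; first by rewrite rpredB ?rpred1.
have m2 : 2 <= m.
  have /intrP[n en] := mi; move: m1 m1'; rewrite en ler1z (eqr_int _ _ 1) => h1 h2.
  by apply: intr_gt1; lia.
by rewrite gerBl ler01 andbT; lra.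
Qed.

(** Descent on the squared distance to [p], counted in units of [e']. A weight outside the alcove
    violates a simple wall or the affine wall, and [straighten_step] applies there; the others are
    in the alcove because hat g dominates every hat b. *)
Lemma straightening :
  (forall a kappa, simple form R0 u a -> P kappa ->
    straightening_relation a 0 kappa) ->
  (forall kappa, P kappa -> straightening_relation (- g) (- c%:R) kappa) ->
  (forall kappa, in_alcove kappa -> Phi kappa = 0) ->
  forall kappa, P kappa -> Phi kappa = 0.
Proof.
move=> hsim haff h0.
have gR := pos_root gRp; have gg := root_dot_gt0 hR0 gR.
have c0 : 0 < c%:R :> R by rewrite ltr0n.
have ug : 0 < form u (co g).
  by rewrite dot_coroot_gt0 ?(pos_neq0 hR0 gRp)// dotC (pos_gt0 gRp).
(* The multiple of u halfway to the affine wall, hence strictly on the inner side of every wall. *)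
pose p := (c%:R / (2 * form u (co g))) *: u.
have q0 : 0 < c%:R / (2 * form u (co g)) by rewrite divr_gt0// mulr_gt0.
have pg : form p (co g) = c%:R / 2.
  by rewrite dotZl; field; rewrite lt0r_neq0.
have [e e0 he] : exists2 e : R, 0 < e & forall a, a \in Rp -> e <= 2 * form p a.
  have pp a : a \in Rp -> 0 < 2 * form p a.
    by move=> /pos_gt0 h; rewrite dotZl (dotC form u a) mulr_gt0// mulr_gt0.
  have {}pp : {in (Rp : seq V), forall a, 0 < 2 * form p a} by move=> a /pp.
  suff [e e0 he] : exists2 e : R, 0 < e & {in (Rp : seq V), forall a, e <= 2 * form p a}.
    by exists e => // a /he.
  elim: (Rp : seq V) pp => [|a r IHr] pp; first by exists 1.
  have [|e e0 he] := IHr; first by move=> b br; apply: pp; rewrite inE br orbT.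
  exists (Num.min (2 * form p a) e); first by rewrite lt_min e0 pp ?inE ?eqxx.
  move=> b; rewrite inE ge_min => /orP[/eqP->|/he->]; first by rewrite lexx.
  by rewrite orbT.
pose e' := Num.min e (form g g * (c%:R / 2)).
have e'0 : 0 < e' by rewrite lt_min e0 mulr_gt0// divr_gt0.
suff main n kappa : P kappa -> form (kappa - p) (kappa - p) < e' *+ n -> Phi kappa = 0.
  move=> kappa Pk.
  apply: (main (Num.truncn (form (kappa - p) (kappa - p) / e')).+1 _ Pk).
  by rewrite -mulr_natl -ltr_pdivrMr// truncnS_gt.
elim: n kappa => [|n IH] kappa Pk hk.
  by move: hk; rewrite mulr0n ltNge dot_ge0.
have IH' x : P x -> form (x - p) (x - p) <= form (kappa - p) (kappa - p) - e' ->
    Phi x = 0.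
  move=> Px hx; apply: IH => //; apply: le_lt_trans hx _.
  by rewrite ltrBlDr -mulrSr.
have [[a sa ka]|nk] := pselect (exists2 a, simple form R0 u a & form kappa a < 0).
  have aRp := simple_pos sa; have aR := pos_root aRp.
  apply: (@straighten_step a 0 e' p) IH' (hsim _ _ sa Pk) => //.
  - have aa := root_dot_gt0 hR0 aR.
    rewrite subr0 dot_coroot mulrC (divfK (lt0r_neq0 aa)).
    by rewrite ge_min he.
  - by rewrite ltNge dot_coroot_ge0 ?(pos_neq0 hR0 aRp)// -ltNge.
have dk : dominant form R0 u kappa.
  apply: simple_dominant => a sa; rewrite leNgt; apply/negP => h; apply: nk.
  by exists a.
have [kgc|kgc] := ltP c%:R (form kappa (co g)).
  apply: (@straighten_step (- g) (- c%:R) e' p) IH' (haff _ Pk) => //.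
  - exact: root_opp hR0 _ gR.
  - by rewrite rpredN natr_int.
  - apply: (@le_trans _ _ (form g g * (c%:R / 2))); first by rewrite ge_min lexx orbT.
    rewrite corootN !dotNr dotNl pg le_eqVlt; apply/orP; left; apply/eqP.
    by field.
  - by rewrite corootN dotNr ltrN2.
apply: h0; split=> // b bRp; have bR := pos_root bRp.
rewrite dotZr mulr_ge0 ?dk ?(ltW (k_gt0 bR))//=.
apply: le_trans kgc; have := datum_highest hD bRp dk.
by rewrite kg dotBl (dotZl form (k b)) subr_ge0 (dotC form (co g)) (dotC form b).
Qed.

End Straightening.

(** * The coroot lattice and separation of points of the open alcove *)

Section CorootLattice.
Variables (R : realType) (V : vectType R) (form : {dot V for idfun}).
Implicit Types (a b x y q : V).
Local Notation s := (reflection form).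
Local Notation co := (coroot form).
Variables (R0 : {fset V}) (u : V).
Hypothesis hR0 : root_system form R0.
Hypothesis hu : forall a, a \in R0 -> form a u != 0.
Local Notation Rp := (pos_roots form R0 u).
Local Notation W := (weyl_group form R0).
Local Notation P := (weight_lattice form R0).

Definition coroot_scalar a : R := 2 / form a a.

Lemma coroot_scalar_gt0 a : a \in R0 -> 0 < coroot_scalar a.
Proof. by move=> aR; rewrite divr_gt0// (root_dot_gt0 hR0). Qed.

Lemma coroot_scalar_refl a b : coroot_scalar (s a b) = coroot_scalar b.
Proof. by rewrite /coroot_scalar reflection_dot. Qed.

Lemma coroot_scalar_int a b : a \in R0 -> b \in R0 ->
  coroot_scalar a / coroot_scalar b * form a (co b) \is a Num.int.
Proof.
move=> aR bR; have aa := root_dot_gt0 hR0 aR; have bb := root_dot_gt0 hR0 bR.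
rewrite (_ : _ * _ = form b (co a)); first exact: root_integral hR0 _ _ aR bR.
rewrite !dot_coroot /coroot_scalar (dotC form b a).
by field; rewrite !lt0r_neq0.
Qed.

(** This is [root_lattice_bidual] for the dual root system; [corootK] turns its roots back into
    coroots of R0. *)
Lemma coroot_lattice_bidual q :
  (forall x, P x -> form q x \is a Num.int) ->
  exists2 l, (forall b, b \in l -> b \in R0) & q = \sum_(b <- l) co b.
Proof.
move=> hq.
have hS := rescaled_root_system hR0 coroot_scalar_gt0
  (fun a b _ _ => coroot_scalar_refl a b) coroot_scalar_int.
have hSu := rescaled_regular coroot_scalar_gt0 hu.
have [|l lS ->] := root_lattice_bidual hS hSu (q := q).
  move=> x hx; apply: hq => b bR; apply: hx.
  by apply/rescaledP; exists b.
exists [seq co b | b <- l].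
  by move=> _ /mapP[b /lS/rescaledP[a aR ->] ->]; rewrite -/(co a) corootK.
by rewrite big_map; apply: eq_bigr => b _; rewrite corootK.
Qed.

Lemma weyl_weight w x : W w -> P x -> P (w x).
Proof.
move=> hw hx b bR; have [w' [hw' k1 k2]] := weyl_inv hw.
rewrite (weyl_adjoint _ _ hw k2) -(isometric_coroot _ (weyl_isometric hw')).
exact/hx/(weyl_root hR0 hw').
Qed.

Lemma root_weight a : a \in R0 -> P a.
Proof. by move=> aR b bR; exact: (root_integral hR0). Qed.

Definition open_alcove x := forall a, a \in Rp -> 0 < form x a < 2 * pi.

Lemma open_alcove_regular x : open_alcove x -> regular form R0 x.
Proof.
move=> hx a /(pos_or hR0 hu)/orP[/hx/expi_lt2pi//|/hx/expi_lt2pi].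
by rewrite dotNr expiN invr_eq1.
Qed.

(* The points of the open alcove are pairwise inequivalent under the Weyl group
   and translations by 2 pi times coroots: a translation relating two of them
   is minuscule and lies in the coroot lattice, so it vanishes. *)
Lemma open_alcove_separated v v' x x' : W v -> W v' ->
  open_alcove x -> open_alcove x' ->
  (forall y, P y -> expi (form (v x) y) = expi (form (v' x') y)) ->
  v = v' /\ x = x'.
Proof.
move=> hv hv' hx hx' hexp.
have [v1 [hv1 k1 k2]] := weyl_inv hv'.
have [v2 [hv2 k3 k4]] := weyl_inv hv.
have p2 : 2 * pi != 0 :> R by rewrite mulf_neq0 ?pnatr_eq0 ?lt0r_neq0 ?pi_gt0.
pose q := (2 * pi)^-1 *: (v1 (v x) - x').
have qE y : 2 * pi * form q y = form x (v2 (v' y)) - form x' y.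
  rewrite dotZl mulVKf// dotBl (weyl_adjoint _ _ hv1 k1).
  by rewrite (weyl_adjoint _ _ hv k4).
have qint y : P y -> form q y \is a Num.int.
  move=> Py; have := hexp _ (weyl_weight hv' Py).
  rewrite (weyl_isometric hv') (weyl_adjoint _ _ hv k4) => e.
  have /expi_eq1[m em] : expi (2 * pi * form q y) = 1.
    by rewrite qE expiD e expiN mulfV// expi_neq0.
  by rewrite (mulfI p2 em) intr_int.
have [l lR ql] := coroot_lattice_bidual qint.
have xbd a : a \in R0 -> -2 * pi < form x a < 2 * pi.
  move=> aR; have p0 := pi_gt0 R.
  have /orP[/hx/andP[h1 h2]|/hx/andP[]] := pos_or hR0 hu aR.
    by apply/andP; split; lra.
  by rewrite dotNr => h1 h2; apply/andP; split; lra.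
have q0 : q = 0.
  rewrite ql; apply: (minuscule_coroot_sum hR0) => // a; rewrite -ql.
  (* For positive [b], 2 pi <q, b> is a number in (-2 pi, 2 pi) minus one in (0, 2 pi), so the
     integer <q, b> can only be -1 or 0. *)
  suff pos b : b \in Rp -> (form q b == 0) || (form q b == -1).
    move=> /(pos_or hR0 hu)/orP[/pos/orP[/eqP->|/eqP->]|/pos].
    - by rewrite !inE eqxx orbT.
    - by rewrite !inE eqxx.
    - rewrite dotNr oppr_eq0 eqr_opp => /orP[/eqP->|/eqP->].
        by rewrite !inE eqxx orbT.
      by rewrite !inE eqxx !orbT.
  move=> bRp; have bR := pos_root bRp.
  have /intrP[m em] := qint _ (root_weight bR).
  have := qE b; rewrite em.
  have := hx' _ bRp; have p0 := pi_gt0 R.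
  have /xbd := weyl_root hR0 hv2 (weyl_root hR0 hv' bR).
  move=> /andP[h1 h2] /andP[h3 h4] h5.
  have m1 : -2 < m%:~R :> R by nra.
  have m2 : m%:~R < 1 :> R by nra.
  rewrite (eqr_int _ _ 0) (_ : -1 = (-1)%:~R :> R)// eqr_int.
  move: m1 m2; rewrite (_ : -2 = (-2)%:~R :> R)// ltr_int ltrz1.
  by clear; lia.
have xE y : form x (v2 (v' y)) = form x' y.
  by apply/eqP; rewrite -subr_eq0 -qE q0 dot0l mulr0.
(* The points x and x' are both positive on positive roots, so the composite preserves the positive
   roots and must be the identity. *)
have vE y : v2 (v' y) = y.
  have := weyl_comp hv2 hv' => /(weyl_pos_id hR0 hu) h.
  have := h _ y; rewrite comp_lfunE; apply => a aRp; rewrite comp_lfunE.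
  have aR := pos_root aRp.
  have wR : v2 (v' a) \in R0 by exact/(weyl_root hR0 hv2)/(weyl_root hR0 hv').
  apply: contraT => /(npos_opp hR0 hu wR)/hx/andP[]; rewrite dotNr xE.
  by have /hx'/andP[] := aRp; lra.
have ev : v = v' by apply/lfunP => y; rewrite -[in LHS](vE y) k4.
split=> //; apply: (@dot_inj _ _ form) => y; by rewrite -xE vE.
Qed.

End CorootLattice.

(** * Linear independence of the evaluations at the nodes *)

Section Kernel.
Variables (R : realType) (V : vectType R) (form : {dot V for idfun}).
Implicit Types (a b x y z mu lambda : V).
Local Notation s := (reflection form).
Local Notation co := (coroot form).
Variables (R0 : {fset V}) (u : V) (k : V -> R) (g : V) (t : V -> R).
Hypothesis hD : affine_datum form R0 u k g t.
Local Notation Rp := (pos_roots form R0 u).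
Local Notation W := (weyl_group form R0).
Local Notation P := (weight_lattice form R0).
Let hR0 := datum_roots hD.
Let hu := datum_regular hD.
Let gRp := datum_g hD.
Variable c : nat.
Hypothesis c_gt0 : (0 < c)%N.
Variables (ws : seq 'End(V)).
Hypothesis ws_uniq : uniq ws.
Hypothesis wsP : forall w, w \in ws <-> W w.
Variables (r : seq V) (xi : V -> V).
Hypothesis r_uniq : uniq r.
Hypothesis r_weight : forall mu, mu \in r -> forall a, a \in R0 ->
  form mu (co (k a *: a)) \is a Num.int.
Hypothesis r_alcove : forall mu, mu \in r -> forall a, a \in Rp ->
  0 <= form mu a <= c%:R.
Hypothesis r_node : forall mu, mu \in r ->
  bethe_grad form R0 u k t c%:R (xi mu) =
    (2 * pi) *: (hat_weyl_vector form R0 u k + mu).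

Lemma node_open_alcove mu : mu \in r -> open_alcove form R0 u (xi mu).
Proof.
move=> mr a aRp.
have c0 : 0 < c%:R :> R by rewrite ltr0n.
exact: (bethe_node_alcove hD c0 (r_alcove mr) (r_node mr) aRp).
Qed.

Lemma weyl_sum_kernel (d : V -> R[i]) :
  (forall lambda, in_alcove form R0 u k c lambda ->
    \sum_(mu <- r) d mu * weyl_sum form R0 u t ws lambda (xi mu) = 0) ->
  forall mu, mu \in r -> d mu = 0.
Proof.
move=> h0.
pose Phi lambda := \sum_(mu <- r) d mu * weyl_sum form R0 u t ws lambda (xi mu).
have hreg mu : mu \in r -> regular form R0 (xi mu).
  by move=> mr; apply: (open_alcove_regular hR0 hu); exact: node_open_alcove.
have rel a tau lambda : a \in R0 ->
    (forall mu w, mu \in r -> W w -> wall_relation form R0 u t a tau (w (xi mu))) ->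
    straightening_relation form t Phi a tau lambda.
  move=> aR hw; rewrite /straightening_relation /Phi mulrDr !mulr_sumr -!big_split/=.
  apply: eq_big_seq => mu mr; rewrite -mulrDr.
  rewrite (weyl_sum_relation ws_uniq wsP lambda aR (fun w => hw _ w mr)).
  by ring.
have Phi0 : forall lambda, P lambda -> Phi lambda = 0.
  apply: (straightening hD c_gt0) => // [a lambda sa _|lambda _].
    apply: rel => [|mu w mr hw]; first exact: simple_root sa.
    apply: (simple_wall hD sa); exact: (regular_weyl hD hw (hreg _ mr)).
  apply: rel => [|mu w mr hw]; first exact: root_opp hR0 _ (pos_root gRp).
  exact: (affine_wall hD hw (hreg _ mr) (r_weight mr) (r_node mr)).
pose C := macdonald_C form Rp t.
pose chi (j : 'End(V) * V) lambda := expi (form (j.1 (xi j.2)) lambda).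
pose J := [seq (v, mu) | v <- ws, mu <- r].
pose f (j : 'End(V) * V) := d j.2 * C (j.1 (xi j.2)).
have J0 : {in J, forall j, f j = 0}.
  apply: (@character_independence _ _ P _ chi J f).
  - by move=> b bR; rewrite dot0l rpred0.
  - by move=> x y hx hy b bR; rewrite dotDl rpredD ?hx ?hy.
  - by move=> j; rewrite /chi dot0r expi0.
  - by move=> j x y; rewrite /chi dotDr expiD.
  - by apply: allpairs_uniq => // -[v1 m1] [v2 m2] _ _ [-> ->].
  - move=> j j' /allpairsP[[v mu] /= [/wsP hv mr ->]].
    move=> /allpairsP[[v' mu'] /= [/wsP hv' mr' ->]] /= neq.
    apply: contrapT => nex.
    have [|ev exi] := open_alcove_separated hR0 hu hv hv' (node_open_alcove mr)
        (node_open_alcove mr').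
      move=> y Py; apply/eqP/negPn/negP => ne; apply: nex.
      by exists y.
    (* The gradient equation recovers the label from the node. *)
    have emu : mu = mu'.
      have p2 : 2 * pi != 0 :> R by rewrite mulf_neq0 ?pnatr_eq0 ?lt0r_neq0 ?pi_gt0.
      have := r_node mr; rewrite exi (r_node mr') => /(scalerI p2).
      by move=> /addrI.
    by move: neq; rewrite ev emu eqxx.
  - move=> lambda /Phi0; rewrite /Phi => e; rewrite /J big_allpairs exchange_big/=.
    rewrite -[RHS]e; apply: eq_bigr => mu _; rewrite mulr_sumr.
    by apply: eq_bigr => v _; rewrite /chi /= mulrA.
move=> mu mr; have id_ws : (\1%VF : 'End(V)) \in ws by apply/wsP; exact: weyl_id.
(* The coefficient of the character at (identity, mu) is d_mu C(xi_mu), and C does not vanish at a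
   regular point. *)
have := J0 (\1%VF, mu); rewrite /J /f /=.
have -> : (\1%VF : 'End(V), mu) \in [seq (v, mu) | v <- ws, mu <- r].
  by apply/allpairsP; exists (\1%VF, mu).
move=> /(_ isT)/eqP; rewrite mulf_eq0 id_lfunE (negbTE (macdonald_C_neq0 hD (hreg _ mr))).
by rewrite orbF => /eqP.
Qed.

End Kernel.

(** * Contractions for the Euclidean form *)

Section Contraction.
Variables (R : realType) (V : vectType R) (form : {dot V for idfun}).
Implicit Types (x y z : V).

Definition dot_lipschitz (f : V -> V) := exists2 K : R, 0 <= K &
  forall x y, form (f x - f y) (f x - f y) <= K * form (x - y) (x - y).

Lemma dot_lipschitzD f g : dot_lipschitz f -> dot_lipschitz g ->
  dot_lipschitz (fun x => f x + g x).
Proof.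
move=> [K K0 hf] [L L0 hg]; exists (2 * K + 2 * L); first by lra.
move=> x y; rewrite opprD addrACA.
move: (hf x y) (hg x y); move: (f x - f y) (g x - g y) (form (x - y) _) => a b w h1 h2.
(* The constant 2 K + 2 L comes from |a + b|^2 <= 2 |a|^2 + 2 |b|^2, which is |a - b|^2 >= 0. *)
have := dot_ge0 form (a - b); rewrite dotBl !dotBr dotDl !dotDr (dotC form b a).
lra.
Qed.

Lemma dot_lipschitz_sum (I : Type) (r : seq I) (f : I -> V -> V) :
  (forall i, dot_lipschitz (f i)) -> dot_lipschitz (fun x => \sum_(i <- r) f i x).
Proof.
move=> h; elim: r => [|i r IH].
  by exists 0 => // x y; rewrite !big_nil subrr dot0l mul0r.
have -> : (fun x => \sum_(j <- i :: r) f j x) =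
    (fun x => f i x + \sum_(j <- r) f j x).
  by apply/funext => x; rewrite big_cons.
exact: dot_lipschitzD.
Qed.

Lemma geometric_cauchy_cvg (a : nat -> R) (s A : R) : 0 <= s < 1 ->
  (forall n, `|a n.+1 - a n| <= A * s ^+ n) -> cvgn a.
Proof.
move=> /andP[s0 s1] h.
have -> : a = (fun n => a 0%N + series (telescope a) n).
  by apply/funext => n; rewrite (eq_sum_telescope a).
apply: is_cvgD; first exact: is_cvg_cst.
apply: normed_cvg; apply: series_le_cvg (h) _ => [n|n|].
- by rewrite normr_ge0.
- exact: le_trans (normr_ge0 _) (h n).
- by apply: is_cvg_geometric_series; rewrite ger0_norm.
Qed.

(** Convergence is tested by pairing with vectors, which reduces it to real sequences: by
    Cauchy-Schwarz the coordinates have geometrically decaying increments. *)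
Lemma dot_contraction_limit (x : nat -> V) (q : R) : 0 <= q < 1 ->
  (forall n, form (x n.+2 - x n.+1) (x n.+2 - x n.+1) <=
             q * form (x n.+1 - x n) (x n.+1 - x n)) ->
  exists l, forall z, (fun n => form (x n) z) @ \oo --> form l z.
Proof.
move=> /andP[q0 q1] hx.
have [d [_ exp1 _]] := dual_basis form (vbasisP {:V}).
(* A rational substitute for the square root of q: s < 1 and q <= s^2. *)
pose s := (1 + q) / 2; have s01 : 0 <= s < 1 by rewrite /s; apply/andP; split; lra.
have sq : q <= s ^+ 2 by rewrite /s; have := sqr_ge0 (1 - q); lra.
pose B n := form (x n.+1 - x n) (x n.+1 - x n).
have hB n : B n <= (s ^+ n) ^+ 2 * B 0%N.
  elim: n => [|n IH]; first by rewrite expr0 expr1n mul1r.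
  apply: le_trans (hx n) _; rewrite -/(B n).
  have B0 := dot_ge0 form (x n.+1 - x n); rewrite -/(B n) in B0.
  rewrite [s ^+ n.+1]exprS exprMn -mulrA; apply: (@le_trans _ _ (s ^+ 2 * B n)).
    exact: ler_wpM2r.
  by apply: ler_wpM2l; [exact: sqr_ge0|exact: IH].
have cv i : cvgn (fun n => form (x n) (d i)).
  have D0 := dot_ge0 form (d i); have B0 := dot_ge0 form (x 1%N - x 0%N).
  (* The constant 1 + y bounds the square root of y = B 0 <d_i, d_i> from above. *)
  apply: (@geometric_cauchy_cvg _ s (1 + B 0%N * form (d i) (d i))) => // n.
  have BD : 0 <= B 0%N * form (d i) (d i) by exact: mulr_ge0.
  have sn : 0 <= s ^+ n by rewrite exprn_ge0//; case/andP: s01.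
  rewrite -dotBl -(@ler_pXn2r _ 2)// ?nnegrE ?mulr_ge0// ?addr_ge0//.
  rewrite real_normK ?num_real//; apply: le_trans (cauchy_schwarz _ _ _) _.
  apply: (@le_trans _ _ ((s ^+ n) ^+ 2 * B 0%N * form (d i) (d i))).
    by apply: ler_wpM2r => //; exact: hB.
  move: BD; set D := form (d i) (d i); set b := B 0%N; set w := s ^+ n => BD.
  have -> : w ^+ 2 * b * D = (b * D) * w ^+ 2 by ring.
  have -> : ((1 + b * D) * w) ^+ 2 = (1 + b * D) ^+ 2 * w ^+ 2 by ring.
  by apply: ler_wpM2r; [exact: sqr_ge0|nra].
exists (\sum_i lim ((fun n => form (x n) (d i)) @ \oo) *: (vbasis {:V})`_i) => z.
rewrite dot_suml.
have -> : (fun n => form (x n) z) =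
    (fun n => \sum_i form (x n) (d i) * form (vbasis {:V})`_i z).
  apply/funext => n; rewrite {1}(exp1 (x n)) dot_suml.
  by apply: eq_bigr => i _; rewrite dotZl.
apply: cvg_big => [|i _]; first exact: add_continuous.
rewrite dotZl; apply: cvgM; last exact: cvg_cst.
exact: cv.
Qed.

End Contraction.

(** * Existence and minimality of the Bethe nodes *)

Section BetheNodes.
Variables (R : realType) (V : vectType R) (form : {dot V for idfun}).
Implicit Types (a b x y z mu : V).
Local Notation co := (coroot form).
Variables (R0 : {fset V}) (u : V) (k : V -> R) (g : V) (t : V -> R).
Hypothesis hD : affine_datum form R0 u k g t.
Local Notation Rp := (pos_roots form R0 u).
Variable c : R.
Hypothesis c_gt0 : 0 < c.
Local Notation G := (bethe_grad form R0 u k t c).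

Lemma bethe_grad_lipschitz : dot_lipschitz form G.
Proof.
apply: dot_lipschitzD.
  exists (c ^+ 2) => [|x y]; first exact: sqr_ge0.
  by rewrite -scalerBr dotZl dotZr mulrA.
(* The conditional makes every summand Lipschitz, as [dot_lipschitz_sum] asks; the bound on t b is
   available only for roots b. *)
rewrite (_ : (fun x => _) = (fun x => \sum_(b <- Rp)
    (if b \in Rp then (k b * bethe_fun (t b) (form x b)) *: b else 0))); last first.
  by apply/funext => x; apply: eq_big_seq => b ->.
apply: dot_lipschitz_sum => b; case: (boolP (b \in Rp)) => [bRp|_]; last first.
  by exists 0 => // x y; rewrite subrr dot0l mul0r.
have [L L0 hL] := bethe_fun_slope (datum_t hD (pos_root bRp)).
have B0 := dot_ge0 form b.
exists (k b ^+ 2 * L ^+ 2 * form b b ^+ 2).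
  by apply: mulr_ge0; [apply: mulr_ge0|]; exact: sqr_ge0.
move=> x y; rewrite -scalerBl -mulrBr.
have [m /andP[m0 mL] ->] := hL (form x b) (form y b).
rewrite -dotBl; move: (x - y) => z; rewrite dotZl dotZr.
have cs := cauchy_schwarz form z b.
have m2 : m ^+ 2 <= L ^+ 2 by rewrite ler_pXn2r// nnegrE.
have -> : k b * (m * form z b) * (k b * (m * form z b) * form b b) =
   k b ^+ 2 * (m ^+ 2 * (form b b * form z b ^+ 2)) by ring.
have -> : k b ^+ 2 * L ^+ 2 * form b b ^+ 2 * form z z =
   k b ^+ 2 * (L ^+ 2 * (form b b * (form z z * form b b))) by ring.
apply: ler_wpM2l; first exact: sqr_ge0.
apply: ler_pM => //; first exact: sqr_ge0.
- by rewrite mulr_ge0// sqr_ge0.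
- exact: ler_wpM2l.
Qed.

(* Picard iteration for [x - (c / K) (G x - y)], a contraction when [G] is
   [c]-strongly monotone and [K] dominates the square of its Lipschitz
   constant. *)
Lemma bethe_grad_surjective y : exists x, G x = y.
Proof.
have [K0 K00 hK] := bethe_grad_lipschitz.
(* The added c^2 + 1 makes K positive and keeps the contraction factor 1 - c^2 / K in [0, 1). *)
pose K := K0 + c ^+ 2 + 1.
have c2 : 0 < c ^+ 2 by rewrite exprn_gt0.
have K_gt0 : 0 < K by rewrite /K; lra.
pose e := c / K; have e0 : 0 < e by rewrite divr_gt0.
pose T x := x - e *: (G x - y).
pose xs n := iter n T 0.
have hT x z : form (T x - T z) (T x - T z) <= (1 - c ^+ 2 / K) * form (x - z) (x - z).
  have -> : T x - T z = (x - z) - e *: (G x - G z).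
    have -> : G x - G z = (G x - y) - (G z - y) by rewrite opprB addrA subrK.
    rewrite [in RHS]scalerBr /T; move: (e *: (G x - y)) (e *: (G z - y)) => A B.
    by rewrite !opprB addrACA [RHS]addrACA [- A - z]addrC.
  have := bethe_grad_mono hD c x z; have := hK x z.
  move: (x - z) (G x - G z) => v w h1 h2.
  rewrite dotBl !dotBr !(dotZl form e) !(dotZr form e) (dotC form v w).
  have eK : e * K = c by rewrite /e divfK// lt0r_neq0.
  have -> : c ^+ 2 / K = e * c by rewrite /e; ring.
  have v0 := dot_ge0 form v.
  have h3 : e * form w w <= c * form v v.
    rewrite -eK -mulrA ler_pM2l//; apply: le_trans h1 _.
    by apply: ler_wpM2r => //; rewrite /K; lra.
  have h4 := ler_wpM2l (ltW e0) h3; have h5 := ler_wpM2l (ltW e0) h2.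
  lra.
have [l hl] : exists l, forall z, (fun n => form (xs n) z) @ \oo --> form l z.
  apply: (@dot_contraction_limit _ _ _ _ (1 - c ^+ 2 / K)) => [|n]; last exact: hT.
  rewrite subr_ge0 ler_pdivrMr// mul1r gtrBl divr_gt0// andbT /K; lra.
exists l; apply: (@dot_inj _ _ form) => z.
have hG : (fun n => form (G (xs n)) z) @ \oo --> form (G l) z.
  rewrite dot_bethe_grad; under eq_fun do rewrite dot_bethe_grad.
  apply: cvgD; first by apply: cvgM; [exact: cvg_cst|exact: hl].
  rewrite big_seq; under eq_fun do rewrite big_seq.
  apply: cvg_big => [|b bRp]; first exact: add_continuous.
  apply: cvgM; last exact: cvg_cst.
  apply: cvgM; first exact: cvg_cst.
  apply: continuous_cvg; last exact: hl.
  exact: (bethe_fun_continuous (datum_t hD (pos_root bRp))).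
have h1 : (fun n => form (xs n) z - form (xs n.+1) z) @ \oo --> (0 : R).
  rewrite -(subrr (form l z)); apply: cvgB; first exact: hl.
  have := hl z; rewrite -(cvg_shiftn 1).
  by under eq_fun do rewrite addn1.
(* Successive differences are e (G x_n - y), so their limit 0 identifies G l with y. *)
have h2 : (fun n => form (xs n) z - form (xs n.+1) z) @ \oo -->
    e * (form (G l) z - form y z).
  rewrite (_ : (fun _ => _) = (fun n => e * (form (G (xs n)) z - form y z))).
    apply: cvgM; first exact: cvg_cst.
    by apply: cvgB; [exact: hG|exact: cvg_cst].
  apply/funext => n; rewrite -[xs n.+1]/(T (xs n)) /T dotBl opprB addrC subrK.
  by rewrite dotZl dotBl.
have /eqP : e * (form (G l) z - form y z) = 0.
  by apply: (norm_cvg_unique h2 h1).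
by rewrite mulf_eq0 (gt_eqF e0)/= subr_eq0 => /eqP.
Qed.

Lemma potential_coefficient a : a \in R0 -> 2 / form a (co (k a *: a)) = k a.
Proof.
move=> aR; rewrite coroot_scale dotZr (dot_coroot_self form); last first.
  exact: root_neq0 (datum_roots hD) _ aR.
by rewrite invfM invrK mulrCA mulfV ?mulr1// pnatr_eq0.
Qed.

Definition abstract_potential mu x : R :=
  c / 2 * form x x - 2 * pi * form (hat_weyl_vector form R0 u k + mu) x +
  \sum_(a <- Rp) k a * oriented_integral (bethe_v (t a)) 0 (form x a).

(* The gradient inequality of a convex function, made strict by the quadratic
   term. *)
Lemma abstract_potential_min mu x z :
  G x = (2 * pi) *: (hat_weyl_vector form R0 u k + mu) -> z != x ->
  abstract_potential mu x < abstract_potential mu z.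
Proof.
move=> hx zx; rewrite -subr_gt0 /abstract_potential.
have d0 : 0 < form (z - x) (z - x) by apply: dot_gt0; rewrite subr_eq0.
have hsum : \sum_(a <- Rp) k a * bethe_fun (t a) (form x a) * form a (z - x) <=
    \sum_(a <- Rp) k a * oriented_integral (bethe_v (t a)) 0 (form z a) -
    \sum_(a <- Rp) k a * oriented_integral (bethe_v (t a)) 0 (form x a).
  rewrite -sumrB big_seq [leRHS]big_seq; apply: ler_sum => a aRp.
  have aR := pos_root aRp; have ta := datum_t hD aR.
  rewrite -mulrBr -mulrA; apply: ler_wpM2l; first exact/ltW/(datum_k_gt0 hD).
  rewrite (dotC form a) dotBl (bethe_vE ta).
  apply: oriented_integral_convex; first exact: bethe_fun_continuous.
  exact: bethe_fun_mono.
have := dot_bethe_grad form R0 u k t c x (z - x); rewrite hx dotZl.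
set r := hat_weyl_vector form R0 u k + mu; set S := \sum_(a <- Rp) _ => e.
rewrite -/S in hsum; move: hsum e.
set I1 := \sum_(a <- Rp) _; set I2 := \sum_(a <- Rp) _ => hsum.
move: d0; rewrite !dotBl !dotBr (dotC form z x) => d0 e.
by have := mulr_gt0 c_gt0 d0; nra.
Qed.

End BetheNodes.

(** * Spherical functions at regular points *)

Section LimitAtRegularPoints.
Variables (R : realType) (V : vectType R) (form : {dot V for idfun}).
Implicit Types (a b x y z : V).
Local Notation co := (coroot form).
Variables (R0 : {fset V}) (u : V) (t : V -> R).
Hypothesis hR0 : root_system form R0.
Local Notation Rp := (pos_roots form R0 u).
Local Notation W := (weyl_group form R0).

Lemma regular_nbhs_filter xi : Filter (regular_nbhs form R0 xi).
Proof.
apply: filter_from_filter; first by exists 1 => /=.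
move=> e1 e2 /= h1 h2; exists (Num.min e1 e2) => /=; first by rewrite lt_min h1.
by move=> z /= [rz]; rewrite lt_min => /andP[].
Qed.

Lemma regular_nbhs_proper xi : regular form R0 xi ->
  ProperFilter (regular_nbhs form R0 xi).
Proof.
move=> hxi; apply: filter_from_proper; first exact: regular_nbhs_filter.
move=> e /= e0; exists xi; split; last by rewrite subrr dot0l sqrtr0.
by move=> a aR; rewrite expiN invr_eq1 hxi.
Qed.

Section Limits.
Variable xi : V.
Let F := regular_nbhs form R0 xi.
Let FF : Filter F := regular_nbhs_filter xi.
#[local] Existing Instance FF.

Lemma cvg_dot y : form z y @[z --> F] --> form xi y.
Proof.
apply/cvgrPdist_lt => e e0.
exists (e / (1 + Num.sqrt (form y y))) => /=.
  by rewrite divr_gt0// ltr_pwDl// sqrtr_ge0.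
move=> z [_ hz]; rewrite distrC -dotBl.
have s0 : 0 < 1 + Num.sqrt (form y y) by rewrite ltr_pwDl// sqrtr_ge0.
have : `|form (z - xi) y| <= Num.sqrt (form (z - xi) (z - xi)) * Num.sqrt (form y y).
  by rewrite -sqrtrM ?dot_ge0// -sqrtr_sqr ler_wsqrtr// cauchy_schwarz.
move=> /le_lt_trans; apply; apply: le_lt_trans (_ : _ <= 
  Num.sqrt (form (z - xi) (z - xi)) * (1 + Num.sqrt (form y y))) _.
  by rewrite ler_wpM2l ?sqrtr_ge0// lerDr.
by rewrite -ltr_pdivlMr.
Qed.

Lemma cvg_real_complex (f : V -> R) (l : R) : f z @[z --> F] --> l ->
  ((f z)%:C%C : R[i]^o) @[z --> F] --> (l%:C%C : R[i]^o).
Proof.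
move=> /cvgrPdist_lt h; apply/cvgrPdist_lt => e.
case: e => [er ei]; rewrite ltcE/= => /andP[/eqP -> er0].
apply: filterS (h _ er0) => z; rewrite -rmorphB normc_def/=.
by rewrite expr0n addr0 sqrtr_sqr ltcR.
Qed.

Lemma expiE (x : R) : expi x = (cos x)%:C%C + 'i%C * (sin x)%:C%C.
Proof.
apply/eqP; rewrite eq_complex/= !(mul0r, mul1r, mulr0, subr0, addr0, add0r).
by rewrite !eqxx.
Qed.

Lemma cvg_expi (f : V -> R) (l : R) : f z @[z --> F] --> l ->
  (expi (f z) : R[i]^o) @[z --> F] --> (expi l : R[i]^o).
Proof.
move=> hf; rewrite expiE; under eq_fun do rewrite expiE.
apply: cvgD.
  by apply: cvg_real_complex; apply: continuous_cvg hf; exact: continuous_cos.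
apply: cvgM; first exact: cvg_cst.
by apply: cvg_real_complex; apply: continuous_cvg hf; exact: continuous_sin.
Qed.

Lemma cvg_dot_lfun (w : 'End(V)) y : W w -> form (w z) y @[z --> F] --> form (w xi) y.
Proof.
move=> hw; have [w' [hw' k1 k2]] := weyl_inv hw.
rewrite (weyl_adjoint _ _ hw k2); under eq_fun do rewrite (weyl_adjoint _ _ hw k2).
exact: cvg_dot.
Qed.

Lemma cvg_one_sub (f : V -> R[i]^o) (l : R[i]^o) : f z @[z --> F] --> l ->
  (1 - f z : R[i]^o) @[z --> F] --> (1 - l : R[i]^o).
Proof.
move=> hf; have h1 : (cst 1 : V -> R[i]^o) z @[z --> F] --> (1 : R[i]^o).
  exact: cvg_cst.
exact: (cvgB h1 hf).
Qed.

Hypothesis hxi : regular form R0 xi.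

Lemma cvg_macdonald_C (w : 'End(V)) : W w ->
  (macdonald_C form Rp t (w z) : R[i]^o) @[z --> F] -->
  (macdonald_C form Rp t (w xi) : R[i]^o).
Proof.
move=> hw; rewrite /macdonald_C big_seq; under eq_fun do rewrite big_seq.
apply: cvg_big => [|b bRp]; first exact: mul_continuous.
have bR := pos_root bRp.
have he : (expi (- form (w z) b) : R[i]^o) @[z --> F] --> (expi (- form (w xi) b) : R[i]^o).
  by apply: cvg_expi; apply: cvgN; exact: cvg_dot_lfun.
apply: cvgM.
  apply: cvg_one_sub; apply: cvgM; [exact: cvg_cst|exact: he].
apply: cvgV; last exact: cvg_one_sub.
apply: one_sub_expiN_neq0; have [w' [hw' k1 k2]] := weyl_inv hw.
by rewrite (weyl_adjoint _ _ hw k2) hxi// (weyl_root hR0).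
Qed.

End Limits.

(** At a regular point no denominator vanishes and every term is continuous. The filter is proper
    because the point belongs to each of its own neighbourhoods. *)
Lemma macdonald_spherical_regular lambda xi : regular form R0 xi ->
  macdonald_spherical form R0 Rp t lambda xi =
  weyl_sum form R0 u t (fset_set W) lambda xi.
Proof.
move=> hxi; have PF := regular_nbhs_proper hxi.
apply: norm_cvg_lim.
have e z : macdonald_sum form R0 Rp t lambda z =
    weyl_sum form R0 u t (fset_set W) lambda z.
  by rewrite /macdonald_sum fsbig_finite//; exact: weyl_finite hR0.
rewrite /weyl_sum big_seq; under eq_fun do rewrite e /weyl_sum big_seq.
apply: cvg_big => [|w]; first exact: add_continuous.
rewrite in_fset_set; last exact: weyl_finite hR0.
rewrite inE => hw; apply: cvgM; first exact: cvg_macdonald_C.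
by apply: cvg_expi; exact: cvg_dot_lfun.
Qed.

End LimitAtRegularPoints.

(** * Bases from invertible matrices *)

Section SquareBasis.
Variables (K : fieldType) (I : choiceType) (X : Type) (b : I -> (X -> K^o)).
Variables (n : nat) (li : 'I_n -> I) (xi : 'I_n -> X).

Lemma is_basis_of_unitmx : injective li -> (forall i, exists j, li j = i) ->
  (forall x, exists j, xi j = x) ->
  \matrix_(i, j) b (li j) (xi i) \in unitmx -> is_basis b.
Proof.
move=> inj_li sur_li sur_xi; set A := \matrix_(i, j) _ => Au.
have AE (e : 'cV[K]_n) j : (A *m e) j 0 = \sum_i e i 0 * b (li i) (xi j).
  by rewrite mxE; apply: eq_bigr => i _; rewrite mxE mulrC.
split=> [s k h i0 i0s|f].
  (* The relation supported on [s] is extended by zero to the full index set. *)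
  pose e : 'cV[K]_n := \col_j (if li j \in s then k (li j) else 0).
  have Ae0 : A *m e = 0.
    apply/colP => j; rewrite AE [RHS]mxE.
    have hj : \sum_(i <- s) k i * b i (xi j) = 0.
      by have := congr1 (fun f => f (xi j)) h; rewrite fct_sumE.
    have ps : perm_eq [seq li i | i <- enum 'I_n & li i \in s] s.
      apply: uniq_perm => [| |x]; last 1 first.
      - apply/mapP/idP => [[l]|xs]; first by rewrite mem_filter => /andP[ls _] ->.
        have [i ei] := sur_li x; exists i => //.
        by rewrite mem_filter mem_enum ei xs.
      - by rewrite map_inj_uniq// filter_uniq// enum_uniq.
      - exact: fset_uniq.
    rewrite -[RHS]hj -(perm_big _ ps) big_map big_filter big_enum_cond/=.
    rewrite [RHS]big_mkcond; apply: eq_bigr => i _; rewrite mxE.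
    by case: ifP => // _; rewrite mul0r.
  have [j ej] := sur_li i0.
  have : e j 0 = 0 by rewrite -[e]mul1mx -(mulVmx Au) -mulmxA Ae0 mulmx0 mxE.
  by rewrite mxE ej i0s.
pose e : 'cV[K]_n := invmx A *m \col_j f (xi j).
exists [fset li j | j in 'I_n]%fset.
have [inv invP] := choice sur_li.
exists (fun i => e (inv i) 0); apply/funext => x; have [j <-] := sur_xi x.
rewrite fct_sumE /= big_imfset/=; last by move=> ? ? _ _ /inj_li.
have := AE e j; rewrite mulmxA mulmxV// mul1mx mxE => ->.
rewrite big_enum/=; apply: eq_bigr => i _.
by rewrite (inj_li _ _ (invP (li i))).
Qed.

End SquareBasis.

(** * Admissible pairs, their duals and the matrix of values *)

Section Assembly.
Variables (R : realType) (V : vectType R) (form : {dot V for idfun}).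
Implicit Types (a b x y z mu lambda : V) (p : admissible_pair).
Local Notation co := (coroot form).
Local Notation s := (reflection form).

Definition hat_scalar p (phi a : V) : R :=
  match p with
  | DualRoots => 2 / form a a
  | RescaledRoots => 2 / form phi phi
  end.

Lemma hatE p phi a : hat form p phi a = hat_scalar p phi a *: a.
Proof. by case: p. Qed.

Lemma hat_rootsE p phi (A : {fset V}) :
  hat_roots form p phi A = rescaled (hat_scalar p phi) A.
Proof.
apply/fsetP => x; apply/imfsetP/rescaledP => -[a aA ->]; exists a => //;
  by rewrite hatE.
Qed.

Lemma highest_root_in_cone (R0 : {fset V}) u phi a :
  highest_root (pos_roots form R0 u) phi -> a \in pos_roots form R0 u ->
  in_cone form R0 u (phi - a).
Proof.
move=> [_ h] /h[k ->] z dz; rewrite dot_suml big_seq; apply: sumr_ge0 => b bR.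
by rewrite dotMnl mulrn_wge0// dotC dz.
Qed.

Section Datum.
Variables (R0 : {fset V}) (u phi : V) (p : admissible_pair) (t : V -> R).
Hypothesis hR0 : root_system form R0.
Hypothesis hirr : irreducible_roots form R0.
Hypothesis hu : forall a, a \in R0 -> form a u != 0.
Local Notation Rp := (pos_roots form R0 u).
Hypothesis phiRp : phi \in Rp.
(** The condition is restricted to the rescaled case so that the section also applies to the dual
    pair: the coroot of phi is in general not the highest root of the dual system. *)
Hypothesis hphi : p = RescaledRoots ->
  forall a, a \in Rp -> in_cone form R0 u (phi - a).
Local Notation k := (hat_scalar p phi).

Lemma hat_scalar_gt0 a : a \in R0 -> 0 < k a.
Proof.
move=> aR; rewrite /hat_scalar; case: (p); rewrite divr_gt0// (root_dot_gt0 hR0)//.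
exact: pos_root phiRp.
Qed.

Lemma hat_scalar_refl a b : a \in R0 -> b \in R0 -> k (s a b) = k b.
Proof. by move=> _ _; rewrite /hat_scalar reflection_dot. Qed.

Lemma hat_scalar_int a b : a \in R0 -> b \in R0 ->
  k a / k b * form a (co b) \is a Num.int.
Proof.
move=> aR bR; rewrite /hat_scalar; case: (p).
  exact: coroot_scalar_int hR0 _ _ aR bR.
have pp := root_dot_gt0 hR0 (pos_root phiRp).
by rewrite mulfV ?mul1r ?lt0r_neq0 ?divr_gt0//; exact: (root_integral hR0).
Qed.

Lemma hat_root_system : root_system form (hat_roots form p phi R0).
Proof.
rewrite hat_rootsE.
exact: (rescaled_root_system hR0 hat_scalar_gt0 hat_scalar_refl hat_scalar_int).
Qed.

Lemma hat_irreducible : irreducible_roots form (hat_roots form p phi R0).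
Proof. by rewrite hat_rootsE; exact: rescaled_irreducible hat_scalar_gt0 hirr. Qed.

Lemma hat_regular a : a \in hat_roots form p phi R0 -> form a u != 0.
Proof. by rewrite hat_rootsE; exact: (rescaled_regular hat_scalar_gt0 hu). Qed.

Lemma hat_pos_roots : hat_roots form p phi Rp =
  pos_roots form (hat_roots form p phi R0) u.
Proof. by rewrite !hat_rootsE; apply: rescaled_pos; exact: hat_scalar_gt0. Qed.

(** In the rescaled case g = phi, because the scaling factor turns phi into its coroot. In the dual
    case every rescaled root is a coroot, and g is the root whose coroot is highest. *)
Lemma hat_highest_exists : exists g, [/\ g \in Rp, k g *: g = co g &
  forall a, a \in Rp -> in_cone form R0 u (k g *: g - k a *: a)].
Proof.
have [hp|hp] : p = RescaledRoots \/ p = DualRoots by case: (p); [right|left].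
  exists phi; split=> //; first by rewrite /hat_scalar hp.
  move=> a aRp; rewrite /hat_scalar hp -scalerBr; apply: in_coneZ; last exact: hphi.
  by rewrite divr_ge0// dot_ge0.
have [th thS hth] := highest_root_exists hat_root_system hat_regular hat_irreducible.
move: thS hth; rewrite -hat_pos_roots !hat_rootsE => /rescaledP[g gRp ->] hth.
exists g; split=> //; first by rewrite /hat_scalar hp.
move=> a aRp; have := hth _ (rescaled_mem _ aRp).
by move=> /(rescaled_in_cone form hat_scalar_gt0).
Qed.

Lemma admissible_datum : (forall a, a \in R0 -> -1 < t a < 1) ->
  (forall a b, a \in R0 -> b \in R0 -> t (s a b) = t b) ->
  exists g, affine_datum form R0 u k g t.
Proof.
move=> ht tr; have [g [gRp kg hg]] := hat_highest_exists.
by exists g; split=> //; [exact: hat_scalar_gt0|exact: hat_scalar_refl|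
  exact: hat_scalar_int].
Qed.

(** The dual pair keeps the tag [p] and replaces R0 and phi by their hats; taking hats there undoes
    the first hat. *)
Lemma hat_scalarK a : a \in R0 ->
  hat form p (hat form p phi phi) (hat form p phi a) = a.
Proof.
move=> aR; rewrite /hat; case: (p); first exact: corootK.
rewrite !(dotZl form) !(dotZr form) scalerA.
have pp := root_dot_gt0 hR0 (pos_root phiRp).
by rewrite (_ : _ * _ = 1) ?scale1r//; field; rewrite lt0r_neq0.
Qed.

Lemma hat_rootsK (A : {fset V}) : (forall a, a \in A -> a \in R0) ->
  hat_roots form p (hat form p phi phi) (hat_roots form p phi A) = A.
Proof.
move=> AR; apply/fsetP => x; apply/imfsetP/idP => /= [[y]|xA].
  by rewrite hat_rootsE => /rescaledP[a aA ->] ->; rewrite -hatE hat_scalarK ?AR.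
exists (hat form p phi x); last by rewrite hat_scalarK ?AR.
by rewrite hat_rootsE hatE; exact: rescaled_mem.
Qed.

Lemma hat_highest_pos : hat form p phi phi \in
  pos_roots form (hat_roots form p phi R0) u.
Proof. by rewrite -hat_pos_roots hat_rootsE hatE; exact: rescaled_mem. Qed.

Lemma hat_highest : p = RescaledRoots ->
  forall a, a \in pos_roots form (hat_roots form p phi R0) u ->
  in_cone form (hat_roots form p phi R0) u (hat form p phi phi - a).
Proof.
move=> hp a; rewrite -hat_pos_roots hat_rootsE => /rescaledP[b bRp ->].
rewrite hat_rootsE; apply/(rescaled_in_cone form hat_scalar_gt0).
rewrite hatE /hat_scalar hp -scalerBr; apply: in_coneZ; last exact: hphi.
by rewrite divr_ge0// dot_ge0.
Qed.

Variable c : nat.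
Local Notation alcoveP :=
  (alcove form (weight_lattice form R0) (hat_roots form p phi Rp) c).
Local Notation alcoveQ :=
  (alcove form (weight_lattice form (hat_roots form p phi R0)) Rp c).

Lemma alcovePE lambda : alcoveP lambda <-> in_alcove form R0 u k c lambda.
Proof.
rewrite /alcove hat_rootsE; split=> -[h1 h2]; split=> // b.
  by move=> bR; apply: h2; exact: rescaled_mem.
by move=> /rescaledP[a aR ->]; exact: h2.
Qed.

Lemma alcoveQE mu : alcoveQ mu <->
  (forall a, a \in R0 -> form mu (co (k a *: a)) \is a Num.int) /\
  (forall a, a \in Rp -> 0 <= form mu a <= c%:R).
Proof.
rewrite /alcove hat_rootsE; split=> -[h1 h2]; split=> // b.
  by move=> bR; apply: h1; exact: rescaled_mem.
by move=> /rescaledP[a aR ->]; exact: h1.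
Qed.

(** A point is determined by its pairings with the positive coroots. These are natural numbers, and
    the alcove inequalities bound them all by the sum [B]. *)
Lemma alcoveP_finite : finite_set alcoveP.
Proof.
pose B := \sum_(b <- R0) c%:R * 2 / (k b * form b b).
pose N := (Num.truncn B).+1.
have term b : b \in R0 -> 0 <= c%:R * 2 / (k b * form b b).
  move=> bR; rewrite divr_ge0 ?mulr_ge0// ?(ltW (hat_scalar_gt0 bR))//.
  exact: dot_ge0.
have bnd x b : alcoveP x -> b \in Rp ->
    exists2 m : nat, (m < N)%N & form x (co b) = m%:R.
  move=> /alcovePE[Px xa] bRp; have bR := pos_root bRp.
  have kb := hat_scalar_gt0 bR; have bb := root_dot_gt0 hR0 bR.
  have /andP[x0 xc] := xa _ bRp; rewrite dotZr in x0 xc.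
  have /intrP[m em] := Px _ bR.
  have e : form x (co b) = (k b * form x b) * 2 / (k b * form b b).
    by rewrite dot_coroot; field; rewrite !lt0r_neq0.
  have m0 : 0 <= form x (co b).
    rewrite e; apply: divr_ge0; first by rewrite mulr_ge0.
    exact/ltW/mulr_gt0.
  have mB : form x (co b) <= B.
    rewrite /B (big_rem b)//=; apply: ler_wpDr.
      by rewrite big_seq sumr_ge0// => a /mem_rem; exact: term.
    by rewrite e ler_pM2r ?invr_gt0 ?mulr_gt0// ler_pM2r.
  move: m0 mB; rewrite em ler0z; case: m em => // m em _ mB.
  exists m => //.
  by rewrite -(ltr_nat R); apply: le_lt_trans mB _; exact: truncnS_gt.
pose f x := [ffun b : Rp => form x (co (val b))].
pose D := (fun h : {ffun Rp -> 'I_N} => [ffun b => (h b)%:R : R]) @` [set: _].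
have fD : finite_set D by apply: finite_image; exact: finite_finset.
apply: (@sub_finite_set _ _ (f @^-1` D)).
  move=> x hx.
  have ex (b : Rp) : exists i : 'I_N, form x (co (val b)) = i%:R.
    by have [m mN ->] := bnd _ _ hx (valP b); exists (Ordinal mN).
  have [h hh] := choice ex; exists [ffun b => h b] => //.
  by apply/ffunP => b; rewrite !ffunE hh.
apply: finite_preimage => // x y _ _ e.
have exy b : b \in Rp -> form x b = form y b.
  move=> bRp; have bb := root_dot_gt0 hR0 (pos_root bRp).
  have := congr1 (fun g : {ffun Rp -> R} => g [` bRp]%fset) e; rewrite !ffunE/=.
  rewrite !dot_coroot => /(mulIf (invr_neq0 (lt0r_neq0 bb))).
  by apply: mulfI; rewrite pnatr_eq0.
apply: (@dot_inj _ _ form) => z.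
have : z \in <<R0>>%VS by rewrite (root_span hR0) memvf.
have : (<<R0>> <= lker (linfun (form (x - y) : V -> R^o)))%VS.
  apply/span_subvP => b bR; rewrite memv_ker lfunE /= dotBl subr_eq0.
  have /orP[h|h] := pos_or hR0 hu bR; first by rewrite exy.
  by have /eqP := exy _ h; rewrite !dotNr eqr_opp.
move=> /subvP h /h; rewrite memv_ker lfunE/= dotBl subr_eq0.
by move/eqP.
Qed.

Hypothesis ht : forall a, a \in R0 -> -1 < t a < 1.
Hypothesis t_refl : forall a b, a \in R0 -> b \in R0 -> t (s a b) = t b.
Hypothesis c_gt0 : (0 < c)%N.
Local Notation W := (weyl_group form R0).
Local Notation G := (bethe_grad form R0 u k t c%:R).
Local Notation rho := (hat_weyl_vector form R0 u k).
Local Notation F := (weyl_sum form R0 u t (fset_set W)).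

Lemma node_exists : exists xi : V -> V, forall mu, G (xi mu) = (2 * pi) *: (rho + mu).
Proof.
have [g hD] := admissible_datum ht t_refl.
have c0 : 0 < c%:R :> R by rewrite ltr0n.
have ex mu := bethe_grad_surjective hD c0 ((2 * pi) *: (rho + mu)).
by have [xi h] := choice ex; exists xi.
Qed.

(** A zero of the gradient is the strict global minimum, so the choice operator in [bethe_node]
    finds it and never falls back on its default. *)
Lemma bethe_nodeE mu x : G x = (2 * pi) *: (rho + mu) ->
  bethe_node form Rp phi p t c mu = x.
Proof.
move=> hx; have [g hD] := admissible_datum ht t_refl.
have c0 : 0 < c%:R :> R by rewrite ltr0n.
have pE z : bethe_potential form Rp phi p t c mu z =
    abstract_potential form R0 u k t c%:R mu z.
  rewrite /bethe_potential /abstract_potential /hat_rho hat_rootsE.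
  rewrite /hat_weyl_vector /rescaled big_imfset/=; last first.
    move=> a b /pos_root aR /pos_root bR.
    exact: (rescaled_inj hR0 hat_scalar_gt0).
  congr (_ + _); apply: eq_big_seq => a aRp.
  by rewrite hatE (potential_coefficient hD (pos_root aRp)).
have lt z : z != x -> bethe_potential form Rp phi p t c mu x <
    bethe_potential form Rp phi p t c mu z.
  by move=> zx; rewrite !pE; exact: (abstract_potential_min hD c0 hx).
apply: xget_unique => [z /lt//|y hy]; apply/eqP/negPn/negP => yx.
have xy : x != y by rewrite eq_sym.
by have := lt_trans (lt _ yx) (hy _ xy); rewrite ltxx.
Qed.

Section Matrix.
Variables (xi : V -> V) (m n : nat) (rP rQ : seq V).
Hypothesis hxi : forall mu, G (xi mu) = (2 * pi) *: (rho + mu).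
Hypothesis rPP : forall lambda, alcoveP lambda -> lambda \in rP.
Hypothesis rQ_uniq : uniq rQ.
Hypothesis rQP : forall mu, mu \in rQ -> alcoveQ mu.
Hypotheses (size_rP : size rP = n) (size_rQ : size rQ = m).

Lemma node_regular mu : mu \in rQ -> regular form R0 (xi mu).
Proof.
move=> mr; have [g hD] := admissible_datum ht t_refl.
have [h1 h2] := (alcoveQE mu).1 (rQP mr).
apply: (open_alcove_regular hR0 hu) => a aRp.
have c0 : 0 < c%:R :> R by rewrite ltr0n.
exact: (bethe_node_alcove hD c0 h2 (hxi mu) aRp).
Qed.

Lemma node_matrix_row_free :
  row_free (\matrix_(i < m, j < n) F (rP`_j) (xi (rQ`_i))).
Proof.
have [g hD] := admissible_datum ht t_refl.
set A := \matrix_(i, j) _; apply: inj_row_free => v vA.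
(* Turns the row vector into a function on V; as [rQ] has no repetitions, each of its entries
   collects a single coordinate. *)
pose d mu := \sum_(i < m | rQ`_i == mu) v 0 i.
have dE (i : 'I_m) : d rQ`_i = v 0 i.
  rewrite /d (bigD1 i)//= big1 ?addr0// => j /andP[ej /eqP[]].
  by apply/val_inj/eqP; move: ej; rewrite nth_uniq ?size_rQ ?ltn_ord.
have d0 : forall mu, mu \in rQ -> d mu = 0.
  apply: (weyl_sum_kernel hD c_gt0 (fset_uniq (fset_set W)) _ rQ_uniq _ _ _).
  - move=> w; rewrite in_fset_set; last exact: weyl_finite hR0.
    by rewrite inE.
  - by move=> mu mr; have [] := (alcoveQE mu).1 (rQP mr).
  - by move=> mu mr; have [] := (alcoveQE mu).1 (rQP mr).
  - by move=> mu _; exact: hxi.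
  - move=> lambda /alcovePE/rPP lr.
    have jn : (index lambda rP < n)%N by rewrite -size_rP index_mem.
    have := congr1 (fun M : 'rV[R[i]]_n => M 0 (Ordinal jn)) vA.
    rewrite !mxE => e; rewrite -[RHS]e (big_nth 0) big_mkord size_rQ.
    by apply: eq_bigr => i _; rewrite dE mxE /= nth_index.
apply/rowP => i; rewrite mxE -dE; apply: d0.
by apply: mem_nth; rewrite size_rQ.
Qed.

Lemma node_count : (m <= n)%N.
Proof.
by have := node_matrix_row_free; rewrite /row_free => /eqP {1}<-; exact: rank_leq_col.
Qed.

End Matrix.

End Datum.
End Assembly.

Theorem theorem2p2 (R : realType) (V : vectType R) (form : {dot V for idfun})
  (R0 Rp : {fset V}) (phi : V) (p : admissible_pair) (t : V -> R) (c : nat)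
  (hR0 : root_system form R0) (hirr : irreducible_roots form R0)
  (hRp : positive_roots form R0 Rp) (hphi : highest_root Rp phi)
  (ht : forall a, a \in R0 -> -1 < t a < 1 /\ t a != 0)
  (htW : forall (w : 'End(V)) a, weyl_group form R0 w -> a \in R0 ->
     t (w a) = t a)
  (hc : (1 < c)%N) :
  let Pc := alcove form (weight_lattice form R0)
                   (hat_roots form p phi Rp) c in
  let hatPc := alcove form (weight_lattice form (hat_roots form p phi R0))
                      Rp c in
  let nodes := bethe_node form Rp phi p t c @` hatPc in
  let M (lambda : Pc) : nodes -> R[i]^o :=
    fun xi => macdonald_spherical form R0 Rp t (val lambda) (val xi) in
  is_basis M.
Proof.
move=> Pc hatPc nodes M.
have [u hu eRp] := hRp.
have {}eRp : Rp = pos_roots form R0 u by rewrite eRp.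
have phiRp : phi \in pos_roots form R0 u by rewrite -eRp; case: hphi.
have hcone a : a \in pos_roots form R0 u -> in_cone form R0 u (phi - a).
  by apply: highest_root_in_cone; rewrite -eRp.
have ht1 a : a \in R0 -> -1 < t a < 1 by case/ht.
have t_refl a b : a \in R0 -> b \in R0 -> t (reflection form a b) = t b.
  by move=> aR; apply: htW; exact: weyl_refl.
have c_gt0 : (0 < c)%N by apply: ltn_trans hc.
have hcone' : p = RescaledRoots -> forall a, a \in pos_roots form R0 u ->
    in_cone form R0 u (phi - a) by move=> _; exact: hcone.
have [xi hxi] := node_exists hR0 hirr hu phiRp hcone' ht1 t_refl c_gt0.
pose S := hat_roots form p phi R0; pose psi := hat form p phi phi.
have hS := hat_root_system p hR0 phiRp.
have hSirr := hat_irreducible p hR0 hirr phiRp.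
have hSu := hat_regular (p := p) hR0 hu phiRp.
have psiSp := hat_highest_pos p hR0 phiRp.
have Sp := hat_pos_roots p hR0 phiRp.
have hSc := hat_highest hR0 phiRp hcone'.
(* The dual pair is taken with t = 0, which is trivially constant on Weyl orbits of [S]. *)
have t0 a : a \in S -> -1 < (0 : R) < 1 by rewrite oppr_lt0 ltr01.
have ht0 a b : a \in S -> b \in S -> (0 : R) = 0 by [].
have [xi' hxi'] := node_exists hS hSirr hSu psiSp hSc t0 ht0 c_gt0.
(* Hats taken twice give back R0, so the two alcoves exchange roles for the dual pair and its nodes
   are labelled by P_c. *)
have KS : hat_roots form p psi S = R0 by apply: (hat_rootsK _ hR0 phiRp).
have KSp : hat_roots form p psi (pos_roots form S u) = pos_roots form R0 u.
  by rewrite -Sp; apply: (hat_rootsK _ hR0 phiRp) => a; exact: pos_root.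
have finP : finite_set Pc by rewrite /Pc eRp; exact: alcoveP_finite.
have finQ : finite_set hatPc.
  by have := alcoveP_finite p hS hSu psiSp c; rewrite KSp /hatPc eRp.
pose rP : seq V := fset_set Pc; pose rQ : seq V := fset_set hatPc.
have rPP x : x \in rP <-> Pc x by rewrite in_fset_set// inE.
have rQP x : x \in rQ <-> hatPc x by rewrite in_fset_set// inE.
have rPu : uniq rP by exact: fset_uniq.
have rQu : uniq rQ by exact: fset_uniq.
have PcE : Pc = alcove form (weight_lattice form R0)
  (hat_roots form p phi (pos_roots form R0 u)) c by rewrite /Pc eRp.
have hatPcE : hatPc = alcove form (weight_lattice form S) (pos_roots form R0 u) c.
  by rewrite /hatPc eRp.
have rPP1 x : alcove form (weight_lattice form R0)
    (hat_roots form p phi (pos_roots form R0 u)) c x -> x \in rP.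
  by rewrite -PcE => /rPP.
have rQP1 x : x \in rQ -> alcove form (weight_lattice form S)
    (pos_roots form R0 u) c x by rewrite -hatPcE => /rQP.
pose n := size rP.
have leQP : (size rQ <= n)%N.
  exact: (node_count hR0 hirr hu phiRp hcone' ht1 t_refl c_gt0 hxi rPP1 rQu rQP1).
have lePQ : (n <= size rQ)%N.
  apply: (node_count hS hSirr hSu psiSp hSc t0 ht0 c_gt0 hxi' _ rPu _ erefl erefl).
    by move=> x; rewrite KSp -hatPcE => /rQP.
  by move=> x /rPP; rewrite KS -Sp PcE.
have sQ : size rQ = n by apply/eqP; rewrite eqn_leq leQP lePQ.
have rowfree := node_matrix_row_free hR0 hirr hu phiRp hcone' ht1 t_refl c_gt0
  hxi rPP1 rQu rQP1 (erefl n) sQ.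
have nodeE mu : bethe_node form Rp phi p t c mu = xi mu.
  by rewrite eRp; exact: (bethe_nodeE hR0 hirr hu phiRp hcone' ht1 t_refl c_gt0 (hxi mu)).
have rPi (i : 'I_n) : rP`_i \in Pc by apply/mem_set/rPP/mem_nth.
have rQi (i : 'I_n) : rQ`_i \in rQ by apply: mem_nth; rewrite sQ.
have nodei (i : 'I_n) : xi rQ`_i \in nodes.
  by apply/mem_set; exists rQ`_i; [exact/rQP/rQi|exact: nodeE].
pose li (i : 'I_n) : Pc := SigSub (rPi i).
pose ni (i : 'I_n) : nodes := SigSub (nodei i).
apply: (@is_basis_of_unitmx R[i] _ _ M n li ni).
- move=> i j /(congr1 val) /= e; apply/val_inj/eqP.
  by rewrite -(nth_uniq 0 _ _ rPu) ?e// -/n ltn_ord.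
- move=> l; have lr : val l \in rP by apply/rPP/set_mem/valP.
  have ln : (index (val l) rP < n)%N by rewrite index_mem.
  by exists (Ordinal ln); apply/val_inj; rewrite /= nth_index.
- move=> x; have [mu /rQP mr e] := set_mem (valP x).
  have ln : (index mu rQ < n)%N by rewrite -sQ index_mem.
  by exists (Ordinal ln); apply/val_inj; rewrite /= nth_index// -e nodeE.
(* Both counts being n, row-freeness is invertibility; the nodes are regular, so the entries of the
   two matrices agree. *)
- rewrite -row_free_unit; congr row_free: rowfree.
  apply/matrixP => i j; rewrite !mxE /M /= eRp macdonald_spherical_regular//.
  exact: (node_regular hR0 hirr hu phiRp hcone' ht1 t_refl c_gt0 hxi rQP1 (rQi i)).
Qed.
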